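(* Let $(\Omega,\rho)$ be a geometric homogeneous space, let $\Theta$ be a bounded domain with $\overline\Theta\subset\Omega$, and fix $p,q$ with $1\le p\le q<\infty$. Assume that the local Poincaré inequality of order $p$ holds. If the Compact Projection Property from $QH^{1,p}(\Theta)$ to $L^q(\Theta)$ holds, then there exists a constant $C_5>0$ such that $$\Big(\int_\Theta|w-w_\Theta|^r\,dx\Big)^{1/r}\le C_5\Big(\int_\Theta|\sqrt{Q}\nabla w|^p\,dx\Big)^{1/p}$$ for every $r\in[1,q]$ and every pair $(w,\nabla w)\in QH^{1,p}(\Theta)$, where $w_\Theta=\frac{1}{|\Theta|}\int_\Theta w\,dx$.
   Context: Geometric homogeneous space: $\Omega\subset\mathbb{R}^n$ is a bounded open set and $\rho:\Omega\times\Omega\to[0,\infty)$ is a symmetric quasimetric, i.e. for some $\kappa\ge1$ and all $x,y,z\in\Omega$: $\rho(x,y)=0$ iff $x=y$; $\rho(x,y)=\rho(y,x)$; $\rho(x,y)\le\kappa[\rho(x,z)+\rho(z,y)]$. Put $B(x,r)=\{y\in\Omega:\rho(x,y)<r\}$. $(\Omega,\rho)$ is a geometric homogeneous space if: (a) every $B(x,r)$, $x\in\Omega$, $r>0$, is open in the Euclidean topology; (b) for $x,y\in\Omega$, $|x-y|\to0$ if $\rho(x,y)\to0$ (equivalently, for every $x\in\Omega$ and $\epsilon>0$ there is $\delta>0$ with $B(x,\delta)\subset\{y\in\Omega:|x-y|<\epsilon\}$); (c) the $\rho$-balls are locally geometrically doubling: for every compact $E\subset\Omega$ there is $\delta=\delta(E)>0$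 such that for all $x\in E$ and $0<r'\le r<\delta$, $B(x,r)$ contains at most $C(r/r')$ disjoint $\rho$-balls of radius $r'$, where $C(r/r')$ is independent of $x$ and $E$. Degenerate Sobolev space: $Q=Q(x)$ is a nonnegative definite symmetric $n\times n$ matrix of measurable functions on $\Omega$ with $|Q|\in L^\infty_{loc}(\Omega)$. For open $\Theta\subset\Omega$, $QH^{1,p}(\Theta)$ is the completion, in the norm $\|w\|_{QH^{1,p}(\Theta)}=\|w\|_{L^p(\Theta)}+\|\sqrt{Q}\nabla w\|_{L^p(\Theta)}$, of the set of locally Lipschitz functions on $\Theta$ with finite norm. Its elements are identified with pairs $(w,\nabla w)$ (limits of pairs $(\varphi_j,\nabla\varphi_j)$), where $w\in L^p(\Theta)$ and $\nabla w$ is a measurable $\mathbb{R}^n$-valued function with $\sqrt{Q}\nabla w\in L^p$, two such functions being identified if $\sqrt{Q}$ times their difference vanishes a.e.; $\nabla w$ need not be determined by $w$. Local Poincaré inequality of order $p$: a continuous function $r_1:\Omega\to(0,\infty)$ is fixed, and there are $C_2>0$, $\mathfrak{b}\ge1$ such that for every $y\in\Omega$ and $r>0$ with $\mathfrak{b}r\in(0,r_1(y))$, writing $B_r=B(y,r)$ and $f_{B_r}=\frac1{|B_r|}\int_{B_r}f\,dx$, $$\Big(\tfrac{1}{|B_r|}\int_{B_r}|f-f_{B_r}|^pdx\Big)^{1/p}\le C_2\,r\Big(\tfrac{1}{|B_{\mathfrak{b}r}|}\int_{B_{\mathfrak{b}r}}|\sqrt{Q}\nabla f|^pdx\Big)^{1/p}\quad\text{for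 all } f\in Lip_{loc}(\Omega).$$ Compact Projection Property from $QH^{1,p}(\Theta)$ to $L^q(\Theta)$: the projection map $i((w,\nabla w))=w$ is a compact mapping from $QH^{1,p}(\Theta)$ into $L^q(\Theta)$ (in particular it takes values in $L^q(\Theta)$). *)

(* Defs.v *)
From HB Require Import structures.
From mathcomp Require Import all_boot all_order all_algebra.
From mathcomp Require complex.
From mathcomp Require Import all_classical all_reals all_analysis.
Set Implicit Arguments.
Unset Strict Implicit.
Unset Printing Implicit Defensive.
Import Order.TTheory GRing.Theory Num.Theory numFieldNormedType.Exports.
Local Open Scope classical_set_scope.
Local Open Scope ring_scope.

Definition psdmx (R : realType) n (A : 'M[R]_n) : Prop :=
  A^T = A /\ forall v : 'rV[R]_n, 0 <= (v *m A *m v^T) 0 0.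

(* By [sqrtmxP] below, this is the positive semidefinite square root of a
   positive semidefinite matrix. *)
Definition sqrtmx (R : realType) n (A : 'M[R]_n) : 'M[R]_n :=
  xget 0 [set S : 'M[R]_n | psdmx S /\ S *m S = A].

Section sqrtmx_exists.
Import complex.
Variable R : realType.

Let interpolation (f : R -> R) (s : seq R) :
  exists p : {poly R}, {in s, forall x, p.[x] = f x}.
Proof.
elim: s => [|x s [p ps]]; first by exists 0.
have [xs|xs] := boolP (x \in s).
  by exists p => y; rewrite inE => /predU1P[->|]; exact: ps.
pose q := \prod_(y <- s) ('X - y%:P).
have qx : q.[x] != 0 by rewrite -rootE root_prod_XsubC.
exists (p + ((f x - p.[x]) / q.[x]) *: q) => y.
rewrite inE hornerD hornerZ => /predU1P[->|ys].
  by rewrite divfK// subrKC.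
have /eqP -> : q.[y] == 0 by rewrite -rootE root_prod_XsubC.
by rewrite mulr0 addr0 ps.
Qed.

Let tr_horner_mx n (A : 'M[R]_n.+1) (p : {poly R}) :
  A^T = A -> (horner_mx A p)^T = horner_mx A p.
Proof.
move=> AT; elim/poly_ind: p => [|p c ih]; first by rewrite rmorph0 trmx0.
rewrite rmorphD rmorphM /= horner_mx_X horner_mx_C linearD /= tr_scalar_mx.
by rewrite -mulmxE trmx_mul ih AT (comm_mx_horner p (erefl (A *m A))).
Qed.

Let eigenvalue_ge0 n (A : 'M[R]_n) a : psdmx A -> eigenvalue A a -> 0 <= a.
Proof.
move=> [_ A0] /eigenvalueP[v vA v0]; have := A0 v.
rewrite vA -scalemxAl mxE.
have -> : (v *m v^T) 0 0 = \sum_j v 0 j ^+ 2.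
  by rewrite mxE; apply: eq_bigr => j _; rewrite mxE expr2.
have [j vj] : exists j, v 0 j != 0.
  apply/existsP; apply: contraNT v0; rewrite negb_exists => /forallP v0.
  by apply/eqP/rowP => j; have := v0 j; rewrite negbK mxE => /eqP.
rewrite pmulr_lge0// (bigD1 j)//= ltr_pwDl ?sumr_ge0// => [|i _].
  by rewrite exprn_even_gt0.
exact: sqr_ge0.
Qed.

Lemma sqrtmx_exists n (A : 'M[R]_n) : psdmx A ->
  exists S : 'M[R]_n, psdmx S /\ S *m S = A.
Proof.
case: n A => [|n] A psdA.
  by exists A; split=> //; apply/matrixP => -[].
pose C : numClosedFieldType := complex R.
pose toC : {rmorphism R -> C} := real_complex R.
pose B := map_mx toC A.
have Breal : B \is a mxOver Num.real.
  by apply/mxOverP => i j; rewrite mxE; apply/complex_realP; exists (A i j).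
have Bsym : B \is hermsymmx.
  apply: realsym_hermsym => //; apply/is_hermitianmxP.
  by rewrite expr0 scale1r map_mx_id// map_trmx psdA.1.
have /orthomx_spectralP := hermitian_normalmx Bsym.
have := hermitian_spectral_diag_real Bsym.
have := spectral_unit B.
set P := spectralmx B; set d := spectral_diag B => Pu /mxOverP dreal BE.
pose e i := Re (d 0 i).
have de i : d 0 i = toC (e i) by rewrite /e -[LHS](RRe_real (dreal 0 i)).
have e0 i : 0 <= e i.
  apply: (eigenvalue_ge0 psdA); rewrite -(eigenvalue_map toC) -/B -de.
  apply/eigenvalueP; exists (row i P).
    have PB : P *m B = diag_mx d *m P by rewrite BE !mulmxA mulmxV// mul1mx.
    by rewrite -row_mul PB row_mul row_diag_mx -scalemxAl -rowE.
  apply/eqP => Pi0; have := congr1 (mulmx^~ (invmx P)) Pi0.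
  rewrite mul0mx -row_mul mulmxV// row1 => /rowP/(_ i)/eqP.
  by rewrite !mxE !eqxx oner_eq0.
have [p pe] := interpolation (fun x => Num.sqrt (Num.sqrt x)) [seq e i | i : 'I_n.+1].
pose T := horner_mx A p.
have TT : T^T = T := tr_horner_mx p psdA.1.
exists (T *m T); split; first split.
- by rewrite trmx_mul TT.
- move=> v; rewrite mulmxA -mulmxA -{2}TT -trmx_mul mxE.
  by apply: sumr_ge0 => j _; rewrite [X in _ * X]mxE -expr2 sqr_ge0.
- have -> : T *m T *m (T *m T) = horner_mx A (p ^+ 4).
    by rewrite (exprD p 2 2) expr2 !rmorphM/=.
  apply: (@map_mx_inj _ _ toC); rewrite map_horner_mx -/B BE.
  rewrite horner_mx_uconjC// horner_mx_diag; congr (_ *m diag_mx _ *m _).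
  apply/rowP => i; rewrite mxE de horner_map/= horner_exp.
  by rewrite pe ?map_f ?mem_enum// (exprM _ 2 2) !sqr_sqrtr ?sqrtr_ge0.
Qed.
End sqrtmx_exists.

Lemma sqrtmxP (R : realType) n (A : 'M[R]_n) :
  psdmx A -> psdmx (sqrtmx A) /\ sqrtmx A *m sqrtmx A = A.
Proof. by move=> /sqrtmx_exists[S AS]; rewrite /sqrtmx; case: xgetP => [T _ /=|/(_ S)]. Qed.

(* Row vectors carry the product sigma-algebra, generated by the coordinates. *)
Section measurable_rV.
Variables (R : realType) (n : nat).

Let coord (i : 'I_n) (v : 'rV[R]_n) : R := v 0 i.

Let rV_set0 : g_sigma_preimage coord set0.
Proof. exact: sigma_algebra0. Qed.

Let rV_setC A : g_sigma_preimage coord A -> g_sigma_preimage coord (~` A).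
Proof. exact: sigma_algebraC. Qed.

Let rV_bigcup (F : (set 'rV[R]_n)^nat) : (forall i, g_sigma_preimage coord (F i)) ->
  g_sigma_preimage coord (\bigcup_i F i).
Proof. exact: sigma_algebra_bigcup. Qed.

HB.instance Definition _ :=
  @isMeasurable.Build (measure_tuple_display default_measure_display)
    'rV[R]_n (g_sigma_preimage coord) rV_set0 rV_setC rV_bigcup.

Lemma measurable_coord (i : 'I_n) :
  measurable_fun [set: 'rV[R]_n] (fun v : 'rV[R]_n => v 0 i).
Proof.
move=> _ Y mY; rewrite setTI; apply: sub_sigma_algebra => /=.
rewrite -bigcup_seq/=; exists i => /=; first by rewrite mem_index_enum.
by exists Y => //; rewrite setTI.
Qed.

Lemma measurable_fun_rV d (T : measurableType d) (f : T -> 'rV[R]_n) :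
  (forall i, measurable_fun [set: T] (fun x => f x 0 i)) ->
  measurable_fun [set: T] f.
Proof.
move=> mf _ A mA.
have : g_sigma_preimage (fun i => coord i \o f) `<=` measurable.
  apply: smallest_sub; first exact: sigma_algebra_measurable.
  move=> B; rewrite -bigcup_seq/= => -[i _ [C mC <-]]; exact: mf.
rewrite g_sigma_preimage_comp; apply.
by exists A.
Qed.

End measurable_rV.

Definition consrV (R : realType) n (p : 'rV[R]_n * measurableTypeR R) :
    'rV[R]_n.+1 :=
  row_mx (p.2 : R)%:M p.1 : 'rV[R]_(1 + n).

Lemma measurable_consrV (R : realType) n :
  measurable_fun [set: 'rV[R]_n * measurableTypeR R] (@consrV R n).
Proof.
apply: measurable_fun_rV => i.
case: (split_ordP (i : 'I_(1 + n))) => j ->.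
  rewrite (_ : (fun _ => _) = snd); first exact: measurable_snd.
  by apply/funext => p; rewrite /consrV (row_mxEl (p.2 : R)%:M) ord1 mxE.
rewrite (_ : (fun _ => _) = (fun v : 'rV[R]_n => v 0 j) \o fst); last first.
  by apply/funext => p; rewrite /consrV (row_mxEr (p.2 : R)%:M).
by apply: measurableT_comp => //; exact: measurable_coord.
Qed.

(* The [n]-fold product of the one-dimensional Lebesgue measure. *)
Fixpoint borel_lebesgue_rV (R : realType) (n : nat) :
    {measure set 'rV[R]_n -> \bar R} :=
  match n with
  | 0 => dirac (0 : 'rV[R]_0)
  | n'.+1 => measure_function_pushforward__canonical__measure_function_Measure
      (borel_lebesgue_rV R n' \x (@lebesgue_measure R))%E
      (@measurable_consrV R n')
  end.

(* Row vectors with the Lebesgue (Caratheodory) measurable sets instead. *)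
Definition Leb (R : realType) (n : nat) : measurableType _ :=
  caratheodory_type (mu_ext (borel_lebesgue_rV R n)).

Definition lebesgue_rV (R : realType) (n : nat) :
    {measure set (Leb R n) -> \bar R} :=
  @completed_measure_extension _ _ _ (borel_lebesgue_rV R n).

(* The norm of the library on ['rV[R]_n] is the sup norm. *)
Definition enorm (R : realType) (n : nat) (v : 'rV[R]_n) : R :=
  Num.sqrt (\sum_i v 0 i ^+ 2).

Section averages.
Variables (R : realType) (n : nat).
Local Notation mu := (lebesgue_rV R n).
Implicit Types (D : set 'rV[R]_n) (p : R) (f : 'rV[R]_n -> R).

Definition Lp_norm D p f : \bar R := 'N[mu]_(p%:E)[(EFin \o f) \_ D]%E.

Definition mean D f : R := (fine (mu D))^-1 * \int[mu]_(x in D) f x.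

Definition Lp_average D p f : \bar R :=
  ((((fine (mu D))^-1)%:E * \int[mu]_(x in D) (`|f x| `^ p)%:E) `^ p^-1)%E.

End averages.

Section geometric_homogeneous_space.
Variables (R : realType) (n : nat).
Variables (Omega : set 'rV[R]_n) (rho : 'rV[R]_n -> 'rV[R]_n -> R).

Definition qball (x : 'rV[R]_n) (r : R) : set 'rV[R]_n :=
  [set y | Omega y /\ rho x y < r].

Definition symmetric_quasimetric : Prop :=
  exists2 kappa : R, 1 <= kappa &
    forall x y z, Omega x -> Omega y -> Omega z ->
      [/\ 0 <= rho x y, rho x y = 0 <-> x = y, rho x y = rho y x &
          rho x y <= kappa * (rho x z + rho z y)].

Definition locally_geometrically_doubling : Prop :=
  exists C : R -> R, forall E : set 'rV[R]_n, compact E -> E `<=` Omega ->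
    exists2 delta : R, 0 < delta &
      forall x r' r, E x -> 0 < r' -> r' <= r -> r < delta ->
      forall (m : nat) (c : 'I_m -> 'rV[R]_n),
        (forall i, Omega (c i)) ->
        (forall i, qball (c i) r' `<=` qball x r) ->
        trivIset [set: 'I_m] (fun i => qball (c i) r') ->
        m%:R <= C (r / r').

Record geometric_homogeneous_space : Prop := {
  ghs_bounded : bounded_set Omega ;
  ghs_open : open Omega ;
  ghs_quasimetric : symmetric_quasimetric ;
  ghs_ball_open : forall x r, Omega x -> 0 < r -> open (qball x r) ;
  ghs_ball_small : forall x (e : R), Omega x -> 0 < e ->
    exists2 delta : R, 0 < delta &
      qball x delta `<=` [set y | Omega y /\ enorm (x - y) < e] ;
  ghs_doubling : locally_geometrically_doubling
}.

End geometric_homogeneous_space.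

Section degenerate_sobolev.
Variables (R : realType) (n : nat) (Q : 'rV[R]_n -> 'M[R]_n).
Local Notation mu := (lebesgue_rV R n).
Implicit Types (U Theta : set 'rV[R]_n) (p q : R).
Implicit Types (f w : 'rV[R]_n -> R) (g : 'rV[R]_n -> 'rV[R]_n).

(* The last field bounds the operator norm of [Q x] for the Euclidean norm. *)
Record degenerate_matrix (Omega : set 'rV[R]_n) : Prop := {
  dm_psd : forall x, Omega x -> psdmx (Q x) ;
  dm_measurable : forall i j,
    measurable_fun (Omega : set (Leb R n)) (fun x => Q x i j) ;
  dm_locally_bounded : forall K : set 'rV[R]_n, compact K -> K `<=` Omega ->
    exists M : R, {ae mu, forall x, K x ->
      forall xi : 'rV[R]_n, enorm (xi *m Q x) <= M * enorm xi}
}.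

Definition lip_loc U f : Prop :=
  forall x, U x -> exists2 V, nbhs x V & [lipschitz f y | y in V].

(* ['D_v f x] is a junk value when the directional derivative does not exist;
   for locally Lipschitz functions this happens only on a null set. *)
Definition gradient f : 'rV[R]_n -> 'rV[R]_n :=
  fun x => \row_i 'D_(delta_mx 0 i) f x.

(* Vectors are rows, so that [g x *m sqrtmx (Q x)] is the transpose of the
   column vector [sqrt Q g]. *)
Definition sqrtQ_norm g : 'rV[R]_n -> R := fun x => enorm (g x *m sqrtmx (Q x)).

Definition QH_norm Theta p w g : \bar R :=
  (Lp_norm Theta p w + Lp_norm Theta p (sqrtQ_norm g))%E.

(* The completion of the locally Lipschitz functions of finite norm, realized
   by its representatives [(w, g)], where [g] is the gradient component. *)
Definition QH Theta p w g : Prop :=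
  [/\ measurable_fun (Theta : set (Leb R n)) w,
      forall i, measurable_fun (Theta : set (Leb R n)) (fun x => g x 0 i),
      (QH_norm Theta p w g < +oo)%E &
      exists phi : nat -> 'rV[R]_n -> R,
        (forall j, lip_loc Theta (phi j) /\
           (QH_norm Theta p (phi j) (gradient (phi j)) < +oo)%E) /\
        QH_norm Theta p (phi j \- w) (gradient (phi j) \- g) @[j --> \oo]
          --> 0%E].

(* When [f] is not integrable on the ball, [mean] is a junk value but the
   left-hand side is [+oo] whatever this value is. *)
Definition local_poincare (Omega : set 'rV[R]_n)
    (rho : 'rV[R]_n -> 'rV[R]_n -> R) (r1 : 'rV[R]_n -> R) p : Prop :=
  exists C2 b : R, [/\ 0 < C2, 1 <= b &
    forall (y : 'rV[R]_n) (r : R), Omega y -> 0 < r -> b * r < r1 y ->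
    forall f, lip_loc Omega f ->
      let B := qball Omega rho y in
      (Lp_average (B r) p (fun x => f x - mean (B r) f)%R <=
       (C2 * r)%:E * Lp_average (B (b * r)%R) p (sqrtQ_norm (gradient f)))%E].

Definition in_Lp Theta q w : Prop :=
  measurable_fun (Theta : set (Leb R n)) w /\ (Lp_norm Theta q w < +oo)%E.

Definition compact_projection Theta p q : Prop :=
  (forall w g, QH Theta p w g -> in_Lp Theta q w) /\
  forall (w : nat -> 'rV[R]_n -> R) (g : nat -> 'rV[R]_n -> 'rV[R]_n) (M : R),
    (forall k, QH Theta p (w k) (g k)) ->
    (forall k, (QH_norm Theta p (w k) (g k) <= M%:E)%E) ->
    exists s : nat -> nat, {homo s : i j / (i < j)%N} /\
    exists2 v, in_Lp Theta q v &
      Lp_norm Theta q (w (s k) \- v) @[k --> \oo] --> 0%E.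

End degenerate_sobolev.

(* Main.v *)
Require Import Defs.
From mathcomp Require Import all_boot all_order all_algebra.
From mathcomp Require Import all_classical all_reals all_analysis.
From mathcomp Require Import measurable_realfun.
From mathcomp Require Import ring lra.
Import Order.TTheory GRing.Theory Num.Theory numFieldNormedType.Exports.
Local Open Scope classical_set_scope.
Local Open Scope ring_scope.
Set Implicit Arguments.
Unset Strict Implicit.
Unset Printing Implicit Defensive.

(** The inequality is proved by compactness.

    Since [Theta] has finite measure, its norms of exponent [r <= q] are at most
    a constant times its norm of exponent [q] ([Lp_norm_inclusion]), so it is
    enough to treat [r = q] ([poincare_exponent_q]).  If the inequality fails for
    every constant, there are [u k] in the Sobolev space that are deviations from
    means, normalized in the norm of exponent [q], with gradients of size at most
    [1 / k.+1].  They form a bounded sequence, and by the compact projection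
    property a subsequence converges to some [v] in the norm of exponent [q].

    The limit [v] is constant ([limit_vanishing_gradient_cst]).  Around each
    point of [Theta] there is a small quasimetric ball on which the local
    Poincare inequality bounds the distance of [u k] to the constants by the size
    of its gradient ([local_poincare_QH]); in the limit [v] is at distance [0]
    from the constants on this ball.  The balls are open for the Euclidean
    topology and nonempty open sets have positive measure, so the connectedness
    of [Theta] forces the local constants to agree
    ([connected_locally_ae_cst]).

    On the other hand no constant is much closer to a function than its mean
    ([Lp_norm_sub_mean]), so that [u k], of norm [1], stays at a positive distance
    from all constants.  This contradicts the convergence to a constant.

    Two points need care.  The local inequality is about functions that are
    Lipschitz near every point of [Omega], whereas the Sobolev space on [Theta] is
    the completion of functions Lipschitz near the points of [Theta] only; they
    are multiplied by a cutoff that is [1] near the ball ([lip_loc_cutoff]).  And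
    the gradients of the approximating functions are given by limits that take
    a default value where they do not exist; the triangle inequality is proved
    with a single measurable term, so that it applies to them
    ([Lnorm_triangle]). *)

(** * Norms of functions that may fail to be measurable *)

Lemma le_poweR (R : realType) (r : R) (x y : \bar R) :
  0 <= r -> (0 <= x)%E -> (x <= y)%E -> (x `^ r <= y `^ r)%E.
Proof.
move=> r0 x0 xy; apply: gt0_ler_poweR => //.
- by rewrite in_itv/= x0 leey.
- by rewrite in_itv/= leey (le_trans x0).
Qed.

Lemma measurable_abs_powR d (T : measurableType d) (R : realType) (D : set T)
    (p : R) (f : T -> R) :
  measurable_fun D f -> measurable_fun D (fun x => `|f x| `^ p).
Proof.
move=> mf; apply: (@measurableT_comp _ _ _ _ _ _ (@powR R ^~ p)) => //.
exact: measurableT_comp.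
Qed.

Lemma powR_le_1DX (R : realType) (a r q : R) :
  0 <= a -> 0 <= r -> r <= q -> a `^ r <= 1 + a `^ q.
Proof.
move=> a0 r0 rq; have [a1|a1] := leP a 1.
  rewrite (@le_trans _ _ 1) ?lerDl ?powR_ge0//.
  by rewrite -(congr1 (@^~ r) (powR1 R)) ge0_ler_powR ?nnegrE.
by rewrite (@le_trans _ _ (a `^ q)) ?lerDr// ler_powR// ltW.
Qed.

Lemma integral_powR_le1D d (T : measurableType d) (R : realType)
    (mu : {measure set T -> \bar R}) (D : set T) (f : T -> R) (r q : R) :
  measurable D -> measurable_fun D f -> 0 <= r -> r <= q ->
  (\int[mu]_(x in D) (`|f x| `^ r)%:E <=
    mu D + \int[mu]_(x in D) (`|f x| `^ q)%:E)%E.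
Proof.
move=> mD mf r0 rq; have mfp s := measurable_abs_powR s mf.
apply: (@le_trans _ _ (\int[mu]_(x in D) (1 + (`|f x| `^ q)%:E))%E).
  apply: ge0_le_integral => //.
  - exact/measurable_EFinP.
  - by apply: emeasurable_funD => //; exact/measurable_EFinP.
  - by move=> x _; rewrite -EFinD lee_fin powR_le_1DX.
rewrite ge0_integralD//; last exact/measurable_EFinP.
by rewrite (integral_cst _ mD 1%E) mul1e.
Qed.

Section Lnorm_lower_integral.
Context d (T : measurableType d) (R : realType).
Variable mu : {measure set T -> \bar R}.
Implicit Types (f g k : T -> R) (p : R).
Local Notation "'N_ p [ f ]" := ('N[mu]_p%:E[EFin \o f])%E.

Let integral_powR_ge0 p f : (0 <= \int[mu]_x (`|f x| `^ p)%:E)%E.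
Proof. by apply: integral_ge0 => x _; rewrite lee_fin powR_ge0. Qed.

Lemma Lnorm_EFin p f : 'N_p[f] = ((\int[mu]_x (`|f x| `^ p)%:E) `^ p^-1)%E.
Proof. by rewrite unlock. Qed.

Lemma poweR_LnormK p f : 0 < p ->
  ('N_p[f] `^ p = \int[mu]_x (`|f x| `^ p)%:E)%E.
Proof. by move=> p0; rewrite poweR_Lnorm// gt_eqF. Qed.

Import HBNNSimple.

(** The integral of a nonnegative function is the supremum of the integrals of
    the simple functions below it, measurable or not, so a bound on the norms of
    all measurable minorants is a bound on the norm.  This covers the gradients of
    locally Lipschitz functions, which are limits of difference quotients with a
    default value where there is no limit. *)
Lemma Lnorm_le_minorant p f (c : \bar R) : 0 < p ->
  (forall k, measurable_fun setT k -> (forall x, 0 <= k x <= `|f x|) ->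
    ('N_p[k] <= c)%E) ->
  ('N_p[f] <= c)%E.
Proof.
move=> p0 fc.
have c0 : (0 <= c)%E.
  have m0 : measurable_fun setT (cst 0 : T -> R) by exact: measurable_cst.
  apply: le_trans (Lnorm_ge0 _ _ _) (fc _ m0 _) => x.
  by rewrite lexx normr_ge0.
rewrite Lnorm_EFin -(poweRe1 c0) -(divff (lt0r_neq0 p0)).
rewrite poweRrM le_poweR ?invr_ge0 ?(ltW p0) ?integral_powR_ge0//.
rewrite ge0_integralTE; last by move=> x; rewrite lee_fin powR_ge0.
apply: ge_ereal_sup => _ [h hf <-].
pose k x := (h x) `^ p^-1.
have h0 x : 0 <= h x by [].
have kp x : `|k x| `^ p = h x.
  by rewrite ger0_norm ?powR_ge0// -powRrM mulVf ?gt_eqF// powRr1.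
have -> : sintegral mu h = ('N_p[k] `^ p)%E.
  by rewrite poweR_LnormK// -integralT_nnsfun; apply: eq_integral => x _; rewrite kp.
rewrite le_poweR ?Lnorm_ge0 ?(ltW p0)//; apply: fc => [|x].
  by apply: (@measurableT_comp _ _ _ _ _ _ (@powR R ^~ p^-1)) => //.
rewrite powR_ge0/=; have := hf x; rewrite lee_fin -kp => kf.
have {}kf : (`|k x| `^ p) `^ p^-1 <= (`|f x| `^ p) `^ p^-1.
  by rewrite ge0_ler_powR// ?nnegrE ?powR_ge0// invr_ge0 ltW.
by move: kf; rewrite -!powRrM divff ?gt_eqF// !powRr1// (ger0_norm (powR_ge0 _ _)).
Qed.

Lemma le_Lnorm p f g : 0 < p -> (forall x, `|f x| <= `|g x|) ->
  ('N_p[f] <= 'N_p[g])%E.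
Proof.
move=> p0 fg; rewrite !Lnorm_EFin le_poweR ?invr_ge0 ?(ltW p0) ?integral_powR_ge0//.
rewrite !ge0_integralTE; try by move=> x; rewrite lee_fin powR_ge0.
apply: ereal_sup_le => _ [h hf <-]; exists h => // x.
apply: le_trans (hf x) _; rewrite lee_fin ge0_ler_powR ?nnegrE//.
exact: ltW.
Qed.

Lemma Lnorm_scale p (a : R) f : 0 < p ->
  ('N_p[(fun x => (a * f x)%R)] = `|a|%:E * 'N_p[f])%E.
Proof.
move=> p0.
have Zm (b : R) k : measurable_fun setT k -> (0 <= b)%R ->
    ('N_p[(fun x => (b * k x)%R)] = b%:E * 'N_p[k])%E.
  move=> mk b0; rewrite !Lnorm_EFin.
  under eq_integral do rewrite normrM (ger0_norm b0) powRM// EFinM.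
  rewrite ge0_integralZl_EFin ?powR_ge0//; last first.
    exact/measurable_EFinP/measurable_abs_powR.
  rewrite poweRM ?integral_powR_ge0 ?lee_fin ?powR_ge0//.
  by rewrite poweR_EFin -powRrM divff ?gt_eqF// powRr1.
have Zle (b : R) g : (0 < b)%R -> ('N_p[(fun x => (b * g x)%R)] <= b%:E * 'N_p[g])%E.
  move=> b0; apply: Lnorm_le_minorant => // k mk kg.
  have -> : k = (fun x => b * (b^-1 * k x)).
    by apply/funext => x; rewrite mulVKf// gt_eqF.
  rewrite Zm//; [|exact: measurable_funM|exact: ltW].
  rewrite lee_pmul2l ?lte_fin// le_Lnorm// => x.
  have /andP[k0 kgx] := kg x.
  rewrite ger0_norm ?mulr_ge0 ?invr_ge0 ?(ltW b0)//.
  by rewrite ler_pdivrMl// -{1}(ger0_norm (ltW b0)) -normrM.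
have -> : ('N_p[(fun x => (a * f x)%R)] = 'N_p[(fun x => (`|a| * f x)%R)])%E.
  by apply/eqP; rewrite eq_le !le_Lnorm// => x; rewrite !normrM normr_id.
have [->|a0] := eqVneq a 0.
  rewrite normr0 mul0e (_ : (fun _ => _) = cst 0%R).
    by rewrite (_ : EFin \o _ = cst 0%E)// Lnorm0// eqe gt_eqF.
  by apply/funext => x; rewrite mul0r.
have {}a0 : (0 < `|a|)%R by rewrite normr_gt0.
apply/eqP; rewrite eq_le Zle//=.
rewrite -lee_pdivlMl//.
rewrite [X in ('N_p[X] <= _)%E](_ : f = (fun x => `|a|^-1 * (`|a| * f x))).
  by rewrite Zle// invr_gt0.
by apply/funext => x; rewrite mulKf// gt_eqF.
Qed.

(** For a measurable [k] between [0] and [`|f + g|], the positive part of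
    [k - `|f|] is a measurable minorant of [`|g|], and the inequality of Minkowski
    applies to it and [`|f|]. *)
Lemma Lnorm_triangle p f g : 1 <= p -> measurable_fun setT f ->
  ('N_p[(fun x => (f x + g x)%R)] <= 'N_p[f] + 'N_p[g])%E.
Proof.
move=> p1 mf; have p0 : 0 < p := lt_le_trans ltr01 p1.
apply: Lnorm_le_minorant => // k mk kfg.
pose m x := Num.max 0 (k x - `|f x|).
have mm : measurable_fun setT m.
  apply: measurable_funTS; apply: measurable_maxr => //.
  by apply: measurable_funB => //; exact: measurableT_comp.
have mg : ('N_p[m] <= 'N_p[g])%E.
  apply: le_Lnorm => // x; rewrite ger0_norm ?le_max ?lexx//.
  rewrite ge_max normr_ge0/= lerBlDl; have /andP[_] := kfg x.
  by move/le_trans; apply; exact: ler_normD.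
apply: le_trans (leeD (lexx _) mg).
apply: le_trans (_ : 'N_p[((fun x => `|f x|) \+ m)%R] <= _)%E.
  apply: le_Lnorm => // x /=.
  have /andP[k0 _] := kfg x.
  rewrite (ger0_norm k0) ger0_norm ?addr_ge0 ?le_max ?lexx//.
  by rewrite -lerBlDl le_max lexx orbT.
apply: le_trans (minkowski_EFin _ _ mm p1) _.
  exact: measurableT_comp.
by rewrite leeD2r// le_Lnorm// => x; rewrite normr_id.
Qed.

End Lnorm_lower_integral.

(** * Lp norms and means on sets of finite measure *)

Section Lp_norm_theory.
Variables (R : realType) (n : nat).
Local Notation mu := (lebesgue_rV R n).
Implicit Types (A D : set 'rV[R]_n) (p q r : R) (f g : 'rV[R]_n -> R).
Local Notation mfun D f := (measurable_fun (D : set (Leb R n)) f).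
Local Notation mset D := (measurable (D : set (Leb R n))).

Lemma Lp_normE D p f : Lp_norm D p f = 'N[mu]_p%:E[EFin \o (f \_ D)]%E.
Proof. by rewrite /Lp_norm restrict_EFin. Qed.

Lemma Lp_norm_ge0 D p f : (0 <= Lp_norm D p f)%E.
Proof. exact: Lnorm_ge0. Qed.

Lemma le_Lp_norm A D p f g : 0 < p -> A `<=` D ->
  (forall x, A x -> `|f x| <= `|g x|) -> (Lp_norm A p f <= Lp_norm D p g)%E.
Proof.
move=> p0 AD fg; rewrite !Lp_normE; apply: le_Lnorm => // x.
rewrite /patch; case: ifPn => [|_]; last by rewrite normr0.
by rewrite inE => Ax; rewrite mem_set; [exact: fg|exact: AD].
Qed.

Lemma eq_Lp_norm D p f g : (forall x, D x -> f x = g x) ->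
  Lp_norm D p f = Lp_norm D p g.
Proof.
move=> fg; rewrite !Lp_normE; congr Lnorm.body; apply/funext => x /=.
by rewrite /patch; case: ifPn => //; rewrite inE => /fg ->.
Qed.

Lemma Lp_normZ D p (a : R) f : 0 < p ->
  Lp_norm D p (fun x => a * f x) = (`|a|%:E * Lp_norm D p f)%E.
Proof.
move=> p0; rewrite !Lp_normE -Lnorm_scale//; congr Lnorm.body.
by apply/funext => x /=; rewrite /patch; case: ifPn => //; rewrite mulr0.
Qed.

Lemma Lp_normN D p f : 0 < p -> Lp_norm D p (fun x => - f x) = Lp_norm D p f.
Proof.
move=> p0; rewrite -[RHS]mul1e -(normr1 R) -normrN -Lp_normZ//.
by apply: eq_Lp_norm => x _; rewrite mulN1r.
Qed.

Lemma Lp_normD D p f g : 1 <= p -> mset D -> mfun D f ->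
  (Lp_norm D p (fun x => (f x + g x)%R) <= Lp_norm D p f + Lp_norm D p g)%E.
Proof.
move=> p1 mD mf; rewrite !Lp_normE.
apply: le_trans (Lnorm_triangle _ _ p1 _).
  rewrite le_eqVlt; apply/orP; left; apply/eqP; congr Lnorm.body.
  by apply/funext => x /=; rewrite /patch; case: ifPn => //; rewrite addr0.
exact/(measurable_restrictT _ mD).
Qed.

Lemma Lp_norm_integral D p f : 0 < p ->
  Lp_norm D p f = ((\int[mu]_(x in D) (`|f x| `^ p)%:E) `^ p^-1)%E.
Proof.
move=> p0; rewrite Lp_normE Lnorm_EFin [in RHS]integral_mkcond; congr poweR.
apply: eq_integral => x _; rewrite /patch; case: ifPn => //.
by rewrite normr0 powR0// gt_eqF.
Qed.

Lemma Lp_norm1 D f : Lp_norm D 1 f = (\int[mu]_(x in D) `|(f x)%:E|)%E.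
Proof.
rewrite Lp_norm_integral// invr1 poweRe1; last first.
  by apply: integral_ge0 => x _; rewrite lee_fin powR_ge0.
by apply: eq_integral => x _; rewrite powRr1.
Qed.

(** Any constant that depends on [D] only will do, so instead of the inequality
    of Hoelder the pointwise bound [t ^ r <= 1 + t ^ q] is applied to [f] divided
    by its norm. *)
Lemma Lp_norm_inclusion D r q f : 1 <= r -> r <= q -> mset D ->
  (mu D < +oo)%E -> mfun D f ->
  (Lp_norm D r f <= (1 + fine (mu D))%:E * Lp_norm D q f)%E.
Proof.
move=> r1 rq mD Doo mf; have r0 : 0 < r := lt_le_trans ltr01 r1.
have q0 : 0 < q := lt_le_trans r0 rq.
have D0 : 0 <= fine (mu D) by rewrite fine_ge0.
have Dfin : (fine (mu D))%:E = mu D by rewrite fineK// ge0_fin_numE.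
have [->|Nf] := eqVneq (Lp_norm D q f) +oo%E.
  by rewrite gt0_muley ?leey// lte_fin ltr_wpDr.
have {}Nf : Lp_norm D q f \is a fin_num.
  by rewrite ge0_fin_numE ?Lp_norm_ge0// ltey.
apply/lee_addgt0Pr => e e0.
(* The error keeps the divisor positive when the norm vanishes. *)
pose t := fine (Lp_norm D q f) + e / (1 + fine (mu D)).
have D1 : 0 < 1 + fine (mu D) by rewrite ltr_wpDr.
have t0 : 0 < t by rewrite ltr_wpDl ?fine_ge0 ?Lp_norm_ge0// divr_gt0.
suff H : (Lp_norm D r (fun x => (t^-1 * f x)%R) <= (1 + fine (mu D))%:E)%E.
  have := H; rewrite Lp_normZ// ger0_norm ?invr_ge0 ?(ltW t0)//.
  rewrite lee_pdivrMl// => /le_trans; apply.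
  rewrite -(fineK Nf) -EFinM -EFinD lee_fin mulrC /t mulrDr.
  by rewrite mulrCA divff ?gt_eqF// mulr1.
set g := fun x => _.
have mg : mfun D g by exact: measurable_funM.
have g1 : (\int[mu]_(x in D) (`|g x| `^ q)%:E <= 1)%E.
  have Ng : (Lp_norm D q g <= 1)%E.
    rewrite Lp_normZ// ger0_norm ?invr_ge0 ?(ltW t0)// lee_pdivrMl// mule1.
    by rewrite -(fineK Nf) lee_fin /t lerDl ltW// divr_gt0.
  have -> : (\int[mu]_(x in D) (`|g x| `^ q)%:E = Lp_norm D q g `^ q)%E.
    rewrite Lp_norm_integral// -poweRrM mulVf ?gt_eqF// poweRe1//.
    by apply: integral_ge0 => x _; rewrite lee_fin powR_ge0.
  by rewrite -(poweR1r q) le_poweR ?Lp_norm_ge0// ltW.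
rewrite Lp_norm_integral//.
apply: (@le_trans _ _ ((1 + fine (mu D))%:E `^ r^-1)%E).
  apply: le_poweR; rewrite ?invr_ge0 ?(ltW r0)//.
    by apply: integral_ge0 => x _; rewrite lee_fin powR_ge0.
  apply: le_trans (integral_powR_le1D _ _ mg (ltW r0) rq) _ => //.
  by rewrite EFinD Dfin [leRHS]addeC leeD2l.
rewrite poweR_EFin lee_fin -[leRHS]powRr1 ?(ltW D1)//.
by rewrite ler_powR ?lerDl// invf_le1.
Qed.

End Lp_norm_theory.

Section mean_theory.
Variables (R : realType) (n : nat).
Local Notation mu := (lebesgue_rV R n).
Implicit Types (A D : set 'rV[R]_n) (p q r : R) (f g : 'rV[R]_n -> R).
Local Notation mfun D f := (measurable_fun (D : set (Leb R n)) f).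
Local Notation mset D := (measurable (D : set (Leb R n))).

Lemma Lp_norm_cst D p (a : R) : 1 <= p -> mset D -> (mu D < +oo)%E ->
  (Lp_norm D p (fun=> a) <= (`|a| * (1 + fine (mu D)))%:E)%E.
Proof.
move=> p1 mD Doo; have p0 : 0 < p := lt_le_trans ltr01 p1.
have D0 : 0 <= fine (mu D) by rewrite fine_ge0.
rewrite (_ : (fun=> a) = (fun x => a * 1)); last by apply/funext => x; rewrite mulr1.
rewrite Lp_normZ// EFinM lee_wpmul2l// Lp_norm_integral//.
under eq_integral do rewrite normr1 powR1.
rewrite (integral_cst _ mD 1%E) mul1e -(@fineK _ (mu D)) ?ge0_fin_numE//.
rewrite poweR_EFin lee_fin (@le_trans _ _ ((1 + fine (mu D)) `^ p^-1))//.
  by rewrite ge0_ler_powR ?nnegrE ?invr_ge0 ?(ltW p0) ?addr_ge0 ?lerDr.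
rewrite -[leRHS]powRr1 ?addr_ge0//.
by rewrite ler_powR ?lerDl// invf_le1.
Qed.

Lemma Lp_norm_sub_fin D p f (c : R) : 1 <= p -> mset D -> (mu D < +oo)%E ->
  mfun D f -> (Lp_norm D p f < +oo)%E ->
  (Lp_norm D p (fun x => (f x - c)%R) < +oo)%E.
Proof.
move=> p1 mD Doo mf Nf.
apply: le_lt_trans (Lp_normD _ p1 mD mf) _.
by rewrite lte_add_pinfty// (le_lt_trans (Lp_norm_cst _ p1 mD Doo))// ltry.
Qed.

Lemma Lp_norm_integrable D p f : 1 <= p -> mset D -> (mu D < +oo)%E ->
  mfun D f -> (Lp_norm D p f < +oo)%E -> mu.-integrable D (EFin \o f).
Proof.
move=> p1 mD Doo mf Nf; apply/integrableP; split; first exact/measurable_EFinP.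
have := Lp_norm_inclusion (lexx 1) p1 mD Doo mf.
rewrite Lp_norm1 => /le_lt_trans; apply.
by rewrite lte_mul_pinfty// lee_fin addr_ge0// fine_ge0.
Qed.

Lemma mean_sub_cst D f (c : R) : mset D -> (0 < mu D)%E -> (mu D < +oo)%E ->
  mu.-integrable D (EFin \o f) ->
  mean D (fun x => f x - c) = mean D f - c.
Proof.
move=> mD D0 Doo fi; have Dfin : mu D \is a fin_num by rewrite ge0_fin_numE.
have Dpos : 0 < fine (mu D) by rewrite fine_gt0// D0 Doo.
have ci : mu.-integrable D (EFin \o (fun=> c)).
  apply/integrableP; split; first exact/measurable_EFinP.
  by rewrite (integral_cst _ mD `|c%:E|%E) lte_mul_pinfty.
rewrite /mean RintegralB// mulrBr; congr (_ - _).
by rewrite Rintegral_cst// mulrC mulfK// gt_eqF.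
Qed.

Lemma norm_mean_le D p f : 1 <= p -> mset D -> (0 < mu D)%E -> (mu D < +oo)%E ->
  mfun D f -> (Lp_norm D p f < +oo)%E ->
  (`|mean D f|%:E <=
    ((fine (mu D))^-1 * (1 + fine (mu D)))%:E * Lp_norm D p f)%E.
Proof.
move=> p1 mD D0 Doo mf Nf.
have Dpos : 0 < fine (mu D) by rewrite fine_gt0// D0 Doo.
have fi := Lp_norm_integrable p1 mD Doo mf Nf.
rewrite /mean normrM ger0_norm ?invr_ge0 ?(ltW Dpos)// !EFinM -muleA.
rewrite lee_pmul2l ?lte_fin ?invr_gt0//.
apply: le_trans (Lp_norm_inclusion (lexx 1) p1 mD Doo mf).
rewrite Lp_norm1.
apply: le_trans (_ : _ <= (\int[mu]_(x in D) `|f x|)%:E)%E _.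
  by rewrite lee_fin le_normr_Rintegral.
rewrite /Rintegral fineK//.
by apply: integrable_fin_num => //; exact: integrable_norm.
Qed.

(** The mean is an almost optimal constant: up to a factor depending on the
    domain only, no constant is closer to [f] than the mean of [f].  This lets
    the means be forgotten when passing to limits. *)
Lemma Lp_norm_sub_mean D p : 1 <= p -> mset D -> (0 < mu D)%E -> (mu D < +oo)%E ->
  exists2 K : R, 0 < K & forall f c, mfun D f -> (Lp_norm D p f < +oo)%E ->
    (Lp_norm D p (fun x => (f x - mean D f)%R) <=
      K%:E * Lp_norm D p (fun x => (f x - c)%R))%E.
Proof.
move=> p1 mD D0 Doo; set m := fine (mu D).
have m0 : 0 < m by rewrite fine_gt0// D0 Doo.
exists (1 + (1 + m) * (m^-1 * (1 + m))).
  by rewrite ltr_pwDl// !mulr_ge0 ?invr_ge0 ?addr_ge0 ?(ltW m0).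
move=> f c mf Nf.
have mfc : mfun D (fun x => f x - c) by exact: measurable_funB.
have Nfc := Lp_norm_sub_fin c p1 mD Doo mf Nf.
have -> : (fun x => f x - mean D f) =
    (fun x => (f x - c) + (- mean D (fun x => f x - c))).
  apply/funext => x; rewrite mean_sub_cst//; first by ring.
  exact: Lp_norm_integrable p1 mD Doo mf Nf.
apply: le_trans (Lp_normD _ p1 mD mfc) _.
rewrite EFinD ge0_muleDl ?lee_fin ?mulr_ge0 ?invr_ge0 ?addr_ge0 ?(ltW m0)// mul1e.
rewrite leeD2l//; apply: le_trans (Lp_norm_cst _ p1 mD Doo) _.
rewrite normrN mulrC !EFinM -[leRHS]muleA lee_pmul2l ?lte_fin ?addr_gt0//.
by rewrite -EFinM norm_mean_le.
Qed.

End mean_theory.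

(** * Lebesgue measure and the topology of row vectors *)

Section lebesgue_rV_topology.
Variable R : realType.

Lemma ball_rV n (x v : 'rV[R]_n) (e : R) : 0 < e ->
  ball x e v <-> forall i, `|x 0 i - v 0 i| < e.
Proof.
move=> e0; split=> [[_ xv] i|xv]; first exact: xv.
by split=> // i j; rewrite !ord1; exact: xv.
Qed.

Lemma measurable_ball_rV n (x : 'rV[R]_n) (e : R) :
  measurable (ball x e : set 'rV[R]_n).
Proof.
have [e0|e0] := ltP 0 e; last first.
  rewrite (_ : ball x e = set0); first exact: measurable0.
  by apply/seteqP; split=> // v [/(le_lt_trans e0)]; rewrite ltxx.
rewrite (_ : ball x e =
    \big[setI/setT]_(i < n) ((fun v : 'rV[R]_n => v 0 i) @^-1` ball (x 0 i) e)).
  apply: bigsetI_measurable => i _; rewrite -[X in measurable X]setTI.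
  apply: measurable_coord => //; apply: open_measurable.
  exact: ball_open.
apply/seteqP; split=> v; rewrite -bigcap_seq /=.
  by move=> /(ball_rV _ _ e0) xv i _; exact: xv.
move=> xv; apply/(ball_rV _ _ e0) => i; apply: xv.
by rewrite /= mem_index_enum.
Qed.

Lemma consrV0 n (p : 'rV[R]_n * measurableTypeR R) : consrV p 0 0 = p.2 :> R.
Proof.
rewrite (_ : (0 : 'I_n.+1) = lshift n (0 : 'I_1)); last exact: val_inj.
by rewrite /consrV (row_mxEl (p.2 : R)%:M) mxE eqxx mulr1n.
Qed.

Lemma consrVS n (p : 'rV[R]_n * measurableTypeR R) (i : 'I_n) :
  consrV p 0 (lift ord0 i) = p.1 0 i.
Proof.
rewrite (_ : lift ord0 i = rshift 1 i); last exact: val_inj.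
by rewrite /consrV (row_mxEr (p.2 : R)%:M).
Qed.

(** The balls of the sup norm are cubes, on which the product measure is a
    product of lengths. *)
Lemma borel_lebesgue_ball n (x : 'rV[R]_n) (e : R) : 0 < e ->
  (0 < borel_lebesgue_rV R n (ball x e) < +oo)%E.
Proof.
move=> e0; elim: n x => [|n IHn] x.
  have -> : ball x e = [set: 'rV[R]_0].
    by apply/seteqP; split=> // v _; apply/(ball_rV _ _ e0) => -[].
  by rewrite /= diracT lte01 ltry.
pose y : 'rV[R]_n := \row_i x 0 (lift ord0 i).
have E : consrV (R := R) (n := n) @^-1` ball x e = ball y e `*` ball (x 0 0) e.
  apply/seteqP; split=> -[v a] /=.
    move=> /(ball_rV _ _ e0) xv; split => /=.
      apply/(ball_rV _ _ e0) => i; rewrite mxE.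
      by have := xv (lift ord0 i); rewrite consrVS.
    by have := xv 0; rewrite consrV0.
  move=> [/(ball_rV _ _ e0) /= yv xa]; apply/(ball_rV _ _ e0) => i.
  have [j ->|->] := unliftP ord0 i; last by rewrite consrV0.
  by have := yv j; rewrite mxE consrVS.
rewrite /= /pushforward E product_measure1E//; last 2 first.
- exact: measurable_ball_rV.
- by apply: open_measurable; exact: ball_open.
have /andP[m0 moo] := IHn y.
rewrite [X in (_ * X)%E](lebesgue_measure_ball _ (ltW e0)).
rewrite mule_gt0 ?lte_fin ?mulrn_wgt0//=.
apply: lte_mul_pinfty; [exact: ltW|by rewrite ge0_fin_numE ?(ltW m0)|exact: ltry].
Qed.

Definition rat_ball n (k : 'rV[rat]_n * nat) : set 'rV[R]_n :=
  ball (map_mx ratr k.1 : 'rV[R]_n) k.2.+1%:R^-1.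

(** The balls with rational centers and radii [1 / m.+1] form a basis of the
    topology. *)
Lemma rat_ballP n (O : set 'rV[R]_n) x : open O -> O x ->
  exists2 k, rat_ball k x & rat_ball k `<=` O.
Proof.
move=> oO Ox; have /nbhs_ballP[e /= e0 eO] := open_nbhs_nbhs (conj oO Ox).
have e20 : 0 < e / 2 by rewrite divr_gt0.
have [m _ me] := near_infty_natSinv_lt (PosNum e20).
pose d : R := m.+1%:R^-1; have d0 : 0 < d by rewrite invr_gt0.
have {}me : d < e / 2 by exact: me (leqnn m).
have zP i : exists q : rat, `|ratr q - x 0 i| < d.
  have : x 0 i - d < x 0 i + d by lra.
  move=> /rat_in_itvoo[q]; rewrite in_itv/= => /andP[q1 q2]; exists q.
  by rewrite ltr_norml; lra.
pose z := \row_i sval (cid (zP i)).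
exists (z, m) => [|v].
  apply/(ball_rV _ _ d0) => i; rewrite !mxE; exact: svalP (cid (zP i)).
move=> /(ball_rV _ _ d0) zv; apply: eO; apply/(ball_rV _ _ e0) => i.
have := zv i; have := svalP (cid (zP i)); rewrite !mxE.
move: (ratr _) => a; rewrite !ltr_norml => /andP[h1 h2] /andP[h3 h4].
by apply/andP; split; lra.
Qed.

Lemma open_measurable_rV n (O : set 'rV[R]_n) : open O -> measurable O.
Proof.
move=> oO.
rewrite (_ : O = \bigcup_(k in [set k | rat_ball k `<=` O]) rat_ball k).
  rewrite bigcup_mkcond; apply: countable_bigcupT_measurable => // k.
  by case: ifPn => // _; exact: measurable_ball_rV.
apply/seteqP; split=> [x /(rat_ballP oO)[k kx kO]|x [k /= kO kx]]; last exact: kO.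
by exists k.
Qed.

Lemma open_measurable_Leb n (O : set 'rV[R]_n) : open O ->
  measurable (O : set (Leb R n)).
Proof.
move=> /open_measurable_rV mO; apply: sub_caratheodory.
exact: sub_sigma_algebra.
Qed.

Lemma lebesgue_rV_ball n (x : 'rV[R]_n) (e : R) : 0 < e ->
  (0 < lebesgue_rV R n (ball x e) < +oo)%E.
Proof.
move=> e0; rewrite /lebesgue_rV /= /completed_measure_extension.
rewrite measurable_mu_extE; first exact: borel_lebesgue_ball.
exact: measurable_ball_rV.
Qed.

Lemma lebesgue_rV_open_gt0 n (O : set 'rV[R]_n) : open O -> O !=set0 ->
  (0 < lebesgue_rV R n O)%E.
Proof.
move=> oO [x Ox]; have /nbhs_ballP[e /= e0 eO] := open_nbhs_nbhs (conj oO Ox).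
have /andP[b0 _] := lebesgue_rV_ball x e0.
apply: lt_le_trans b0 _; apply: le_measure => //; rewrite inE.
- by apply: open_measurable_Leb; exact: ball_open.
- exact: open_measurable_Leb.
Qed.

Lemma lebesgue_rV_bounded_lty n (D : set 'rV[R]_n) :
  measurable (D : set (Leb R n)) -> bounded_set D ->
  (lebesgue_rV R n D < +oo)%E.
Proof.
move=> mD [M [_ DM]].
have M0 : 0 < `|M| + 2 by rewrite ltr_wpDl.
have /andP[_ boo] := lebesgue_rV_ball (0 : 'rV[R]_n) M0.
apply: le_lt_trans boo; apply: le_measure => //; rewrite ?inE//.
  by apply: open_measurable_Leb; exact: ball_open.
move=> x Dx; rewrite -ball_normE /= sub0r normrN.
apply: (@le_lt_trans _ _ (`|M| + 1)); last by rewrite ltrD2l ltr1n.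
by apply: DM => //; rewrite (le_lt_trans (ler_norm _))// ltrDl.
Qed.

(** Countably many rational balls, each with a negligible exceptional set, cover
    [D]. *)
Lemma ae_locally_ae n (D : set 'rV[R]_n) (P : 'rV[R]_n -> Prop) :
  (forall y, D y -> exists U, [/\ open U, U y &
    {ae lebesgue_rV R n, forall x, U x -> P x}]) ->
  {ae lebesgue_rV R n, forall x, D x -> P x}.
Proof.
move=> loc.
pose good k := {ae lebesgue_rV R n, forall x, rat_ball k x -> P x}.
(* Balls on which the property may fail on a large set are discarded. *)
pose F (i : nat) : set 'rV[R]_n :=
  if @pickle_inv ('rV[rat]_n * nat)%type i is Some k then
    (if `[< good k >] then rat_ball k `&` [set x | ~ P x] else set0) else set0.
have nF i : (lebesgue_rV R n).-negligible (F i).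
  rewrite /F; case: pickle_inv => [k|]; last exact: negligible_set0.
  case: asboolP => [gk|_]; last exact: negligible_set0.
  apply: negligibleS gk => x [kx nPx] /= /(_ kx); exact: nPx.
apply: negligibleS (negligible_bigcup nF) => x /= /not_implyP[Dx nPx].
have [U [oU Ux aeU]] := loc _ Dx.
have [k kx kU] := rat_ballP oU Ux.
exists (pickle k) => //; rewrite /F pickleK_inv.
case: asboolP => // -[]; apply: negligibleS aeU => v /= nv Uv; apply: nv => kv.
by apply: Uv; exact: kU.
Qed.

(** The sets on which the function is locally almost everywhere equal to a
    given constant are open, and disjoint because nonempty open sets are not
    negligible. *)
Lemma connected_locally_ae_cst n (D : set 'rV[R]_n) (v : 'rV[R]_n -> R) :
  connected D -> D !=set0 ->
  (forall y, D y -> exists U c, [/\ open U, U y &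
    {ae lebesgue_rV R n, forall x, U x -> v x = c}]) ->
  exists c, {ae lebesgue_rV R n, forall x, D x -> v x = c}.
Proof.
move=> cD [y0 Dy0] loc.
pose A (c : R) : set 'rV[R]_n := [set y | exists U, [/\ open U, U y &
    {ae lebesgue_rV R n, forall x, U x -> v x = c}]].
have oA c : open (A c).
  rewrite openE => y [U [oU Uy aeU]].
  by apply: filterS (open_nbhs_nbhs (conj oU Uy)) => z Uz; exists U.
have uA c c' y : A c y -> A c' y -> c = c'.
  move=> [U [oU Uy aeU]] [V [oV Vy aeV]]; apply: contrapT => cc'.
  have oUV : open (U `&` V) by exact: openI.
  have : (0 < lebesgue_rV R n (U `&` V))%E.
    by apply: lebesgue_rV_open_gt0 => //; exists y.
  rewrite (_ : lebesgue_rV R n (U `&` V) = 0%E) ?ltxx//.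
  apply: measure_negligible; first exact: open_measurable_Leb.
  apply: negligibleS (negligibleU aeU aeV) => x [Ux Vx] /=.
  apply: contrapT => /not_orP[/contrapT/(_ Ux) vc /contrapT/(_ Vx) vc'].
  by apply: cc'; rewrite -vc.
have [U0 [c0 [oU0 U0y ae0]]] := loc _ Dy0.
exists c0; suff DA : D `&` A c0 = D.
  by apply: ae_locally_ae => y; rewrite -DA => -[].
apply: cD.
- by exists y0; split => //; exists U0.
- by exists (A c0).
- exists (~` \bigcup_(c in [set c | c <> c0]) A c).
    by rewrite closedC; apply: bigcup_open => c _.
  apply/seteqP; split=> y [Dy].
    by move=> Ay; split=> // -[c /= cc0 Acy]; apply: cc0; exact: uA Acy Ay.
  move=> nAy; split=> //; have [U [c [oU Uy aeU]]] := loc _ Dy.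
  have [<-|cc0] := pselect (c = c0); first by exists U.
  by exfalso; apply: nAy; exists c => //; exists U.
Qed.

End lebesgue_rV_topology.

(** * Euclidean lengths and the degenerate gradient norm *)

Section euclidean_norm.
Variable R : realType.
Implicit Types n : nat.

Lemma enorm_ge0 n (v : 'rV[R]_n) : 0 <= enorm v.
Proof. exact: sqrtr_ge0. Qed.

Lemma enormZ n (a : R) (v : 'rV[R]_n) : enorm (a *: v) = `|a| * enorm v.
Proof.
rewrite /enorm -sqrtr_sqr -sqrtrM ?sqr_ge0// mulr_sumr; congr Num.sqrt.
by apply: eq_bigr => i _; rewrite mxE exprMn.
Qed.

Lemma normr_le_enorm n (v : 'rV[R]_n) i : `|v 0 i| <= enorm v.
Proof.
rewrite -sqrtr_sqr ler_wsqrtr// (bigD1 i)//= lerDl sumr_ge0// => j _.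
exact: sqr_ge0.
Qed.

(** The inequality of Cauchy and Schwarz, from the identity of Lagrange: the
    squares [(u i * v j - u j * v i) ^+ 2] have a nonnegative sum. *)
Lemma dot_le_enorm n (u v : 'rV[R]_n) :
  \sum_i u 0 i * v 0 i <= enorm u * enorm v.
Proof.
have s0 (w : 'rV[R]_n) : 0 <= \sum_i w 0 i ^+ 2.
  by rewrite sumr_ge0// => i _; exact: sqr_ge0.
rewrite /enorm -sqrtrM//; apply: le_trans (ler_norm _) _.
rewrite -sqrtr_sqr ler_wsqrtr//.
set A := \sum_i u 0 i ^+ 2; set B := \sum_i v 0 i ^+ 2.
set C := \sum_i u 0 i * v 0 i.
have : 0 <= \sum_i \sum_j (u 0 i * v 0 j - u 0 j * v 0 i) ^+ 2.
  by rewrite sumr_ge0// => i _; rewrite sumr_ge0// => j _; exact: sqr_ge0.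
suff -> : \sum_i \sum_j (u 0 i * v 0 j - u 0 j * v 0 i) ^+ 2 =
    A * B + A * B - 2 * (C * C) by move=> ?; rewrite expr2; lra.
have AB : A * B = \sum_i \sum_j u 0 i ^+ 2 * v 0 j ^+ 2.
  by rewrite mulr_suml; apply: eq_bigr => i _; rewrite mulr_sumr.
have BA : A * B = \sum_i \sum_j u 0 j ^+ 2 * v 0 i ^+ 2.
  by rewrite AB exchange_big.
rewrite {1}AB BA mulr_suml mulr_sumr -big_split -sumrB /=.
apply: eq_bigr => i _; rewrite !mulr_sumr -big_split -sumrB /=.
apply: eq_bigr => j _; by ring.
Qed.

Lemma enormD n (u v : 'rV[R]_n) : enorm (u + v) <= enorm u + enorm v.
Proof.
have s0 (w : 'rV[R]_n) : 0 <= \sum_i w 0 i ^+ 2.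
  by rewrite sumr_ge0// => i _; exact: sqr_ge0.
rewrite -[leRHS]ger0_norm ?addr_ge0 ?enorm_ge0// -sqrtr_sqr.
rewrite {1}/enorm ler_wsqrtr// sqrrD /enorm !sqr_sqrtr//.
have -> : \sum_i (u + v) 0 i ^+ 2 =
    \sum_i u 0 i ^+ 2 + (\sum_i u 0 i * v 0 i) *+ 2 + \sum_i v 0 i ^+ 2.
  rewrite -sumrMnl -!big_split /=; apply: eq_bigr => i _.
  by rewrite mxE sqrrD.
by rewrite lerD2r lerD2l lerMn2r/= dot_le_enorm.
Qed.

End euclidean_norm.

Lemma measurable_sqrt d (T : measurableType d) (R : realType) (D : set T)
    (f : T -> R) : measurable_fun D f -> measurable_fun D (fun x => Num.sqrt (f x)).
Proof.
move=> mf; apply: measurableT_comp mf.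
by apply: continuous_measurable_fun => x; exact: sqrt_continuous.
Qed.

Section sqrtQ_norm_theory.
Variables (R : realType) (n : nat) (Q : 'rV[R]_n -> 'M[R]_n).
Implicit Types (g h : 'rV[R]_n -> 'rV[R]_n).

Lemma sqrtQ_norm_ge0 g x : 0 <= sqrtQ_norm Q g x.
Proof. exact: enorm_ge0. Qed.

Lemma sqrtQ_normZ (a : R) g x :
  sqrtQ_norm Q (fun y => a *: g y) x = `|a| * sqrtQ_norm Q g x.
Proof. by rewrite /sqrtQ_norm -scalemxAl enormZ. Qed.

Lemma sqrtQ_normD g h x :
  sqrtQ_norm Q (fun y => g y + h y) x <= sqrtQ_norm Q g x + sqrtQ_norm Q h x.
Proof. by rewrite /sqrtQ_norm mulmxDl enormD. Qed.

Lemma sqrtQ_norm_quadratic g x : psdmx (Q x) ->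
  sqrtQ_norm Q g x = Num.sqrt (\sum_i \sum_j g x 0 i * Q x i j * g x 0 j).
Proof.
move=> /sqrtmxP[[ST _] SS]; rewrite /sqrtQ_norm /enorm; congr Num.sqrt.
set S := sqrtmx (Q x) in ST SS *.
have -> : \sum_i (g x *m S) 0 i ^+ 2 = (g x *m S *m (g x *m S)^T) 0 0.
  by rewrite [RHS]mxE; apply: eq_bigr => i _; rewrite expr2 [X in _ = _ * X]mxE.
rewrite trmx_mul ST mulmxA -(mulmxA (g x)) SS mxE exchange_big/=.
by apply: eq_bigr => j _; rewrite !mxE mulr_suml.
Qed.

(** The square root of [Q] is obtained by choice, but the length of its product
    with a vector is the square root of a quadratic form in the entries of
    [Q]. *)
Lemma measurable_sqrtQ_norm (Omega D : set 'rV[R]_n) g :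
  degenerate_matrix Q Omega -> open Omega -> open D -> D `<=` Omega ->
  (forall i, measurable_fun (D : set (Leb R n)) (fun x => g x 0 i)) ->
  measurable_fun (D : set (Leb R n)) (sqrtQ_norm Q g).
Proof.
move=> QO oO oD DO mg.
have mD := open_measurable_Leb oD.
have E : {in (D : set (Leb R n)), (fun x : Leb R n =>
    Num.sqrt (\sum_i \sum_j g x 0 i * Q x i j * g x 0 j)) =1 sqrtQ_norm Q g}.
  move=> x; rewrite inE => Dx; rewrite sqrtQ_norm_quadratic//.
  by apply: (dm_psd QO); exact: DO.
apply: (eq_measurable_fun _ E).
apply: measurable_sqrt.
apply: measurable_sum => i; apply: measurable_sum => j.
apply: measurable_funM; last exact: mg.
apply: measurable_funM; first exact: mg.
apply: measurable_funS (dm_measurable QO i j) => //.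
exact: open_measurable_Leb.
Qed.

End sqrtQ_norm_theory.

(** * Locally Lipschitz functions and their gradients *)

Section locally_lipschitz.
Variables (R : realType) (n : nat).
Implicit Types (U : set 'rV[R]_n) (f : 'rV[R]_n -> R).

Lemma lip_locP U f : lip_loc U f <->
  forall x, U x -> exists2 e : R, 0 < e & exists2 L : R, 0 <= L &
    forall y z, ball x e y -> ball x e z -> `|f y - f z| <= L * `|y - z|.
Proof.
split=> lf x Ux.
  have [V /nbhs_ballP[e /= e0 eV] [M [Mreal fM]]] := lf x Ux.
  exists e => //; exists (`|M| + 1); first by rewrite addr_ge0.
  move=> y z xy xz; have := fM (`|M| + 1).
  rewrite (le_lt_trans (ler_norm M)) ?ltrDl// => /(_ isT (y, z)); apply.
  by split; apply: eV.
have [e e0 [L L0 fL]] := lf x Ux.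
exists (ball x e); first exact: nbhsx_ballx.
apply: (@klipschitzW _ _ _ L).
  exact: (@globally_properfilter _ _ (x, x) (conj (ballxx _ e0) (ballxx _ e0))).
by move=> [y z] [/= xy xz]; exact: fL.
Qed.

Lemma lip_loc_affine U f (a c : R) : lip_loc U f ->
  lip_loc U (fun x => a * (f x - c)).
Proof.
move=> /lip_locP lf; apply/lip_locP => x Ux.
have [e e0 [L L0 fL]] := lf x Ux.
exists e => //; exists (`|a| * L) => [|y z xy xz]; first by rewrite mulr_ge0.
rewrite -mulrBr (_ : f y - c - (f z - c) = f y - f z); last by ring.
by rewrite normrM -mulrA ler_wpM2l// fL.
Qed.

Lemma lip_loc_continuous_at U f x : lip_loc U f -> U x -> {for x, continuous f}.
Proof.
move=> /lip_locP lf Ux; have [e e0 [L L0 fL]] := lf x Ux.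
have L1 : 0 < L + 1 by rewrite ltr_wpDl.
move=> A /nbhs_ballP[d /= d0 dA]; apply/nbhs_ballP.
exists (Num.min e (d / (L + 1))); first by rewrite /= lt_min e0 divr_gt0.
move=> y xy; apply: dA; rewrite -ball_normE /=.
have xye : ball x e y by apply: le_ball xy; rewrite ge_min lexx.
apply: le_lt_trans (fL x y (ballxx _ e0) xye) _.
apply: (@le_lt_trans _ _ ((L + 1) * `|x - y|)); first by rewrite ler_wpM2r// lerDl.
rewrite -ltr_pdivlMl// mulrC.
have : ball x (d / (L + 1)) y by apply: le_ball xy; rewrite ge_min lexx orbT.
by rewrite -ball_normE.
Qed.

Lemma lip_loc_measurable U f : open U -> lip_loc U f ->
  measurable_fun (U : set (Leb R n)) f.
Proof.
move=> oU lf.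
apply: (@measurability _ _ _ _ _ _ (@RGenOpens.G R)).
  exact: RGenOpens.measurableE.
move=> _ [_ [a [b ->] <-]]; apply: open_measurable_Leb.
rewrite openE => x [Ux fx]; apply: filterI; first exact: open_nbhs_nbhs.
apply: (lip_loc_continuous_at lf Ux); apply: open_nbhs_nbhs; split => //.
Qed.

End locally_lipschitz.

Section gradient_affine.
Variables (R : realType).

(** Also true when [f] has no limit along [F], since [lim] is then [0]. *)
Lemma lim_scale (T : Type) (F : set_system T) (FF : ProperFilter F)
    (f : T -> R) (a : R) : a != 0 ->
  lim ((fun x => a * f x) @ F) = a * lim (f @ F).
Proof.
have scale g (b : R) l : g x @[x --> F] --> l -> b * g x @[x --> F] --> b * l.
  by move=> gl; exact: (cvgM (cvg_cst b) gl).
move=> a0; have [cf|dcf] := pselect (cvg (f @ F)).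
  by rewrite (cvg_lim _ (scale _ a _ cf)).
rewrite (dvgP dcf) dvgP => [|/cvg_ex[l caf]]; first by rewrite mulr0.
apply: dcf; apply/cvg_ex; exists (a^-1 * l).
rewrite (_ : f = (fun x => a^-1 * (a * f x))); first exact: scale caf.
by apply/funext => x; rewrite mulKf.
Qed.

Lemma gradient_affine n (f : 'rV[R]_n -> R) (a c : R) : a != 0 ->
  gradient (fun x => a * (f x - c)) = (fun x => a *: gradient f x).
Proof.
move=> a0; apply/funext => x; apply/rowP => i; rewrite !mxE /derive.
rewrite -lim_scale//.
rewrite (_ : (fun h : R => h^-1 *: _) = (fun h : R =>
    a * (h^-1 *: ((f \o shift x) (h *: delta_mx 0 i) - f x))))//.
apply/funext => h /=.
rewrite -mulrBr (_ : _ - c - _ = f (h *: delta_mx 0 i + x) - f x); last by ring.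
by rewrite -scalerAr.
Qed.

Lemma gradient_near n (f h : 'rV[R]_n -> R) x :
  (\near x, f x = h x) -> gradient f x = gradient h x.
Proof.
by move=> fh; apply/rowP => i; rewrite !mxE; exact: near_eq_derive.
Qed.

End gradient_affine.

(** * Affine changes of functions in the Sobolev space *)

Section degenerate_sobolev_theory.
Variables (R : realType) (n : nat) (Q : 'rV[R]_n -> 'M[R]_n).
Local Notation mu := (lebesgue_rV R n).
Variables (Theta : set 'rV[R]_n) (p : R).
Hypotheses (oTheta : open Theta) (bTheta : bounded_set Theta) (p1 : 1 <= p).
Implicit Types (w : 'rV[R]_n -> R) (g : 'rV[R]_n -> 'rV[R]_n).

Let p0 : 0 < p := lt_le_trans ltr01 p1.
Let mTheta : measurable (Theta : set (Leb R n)) := open_measurable_Leb oTheta.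
Let Theta_lty : (mu Theta < +oo)%E := lebesgue_rV_bounded_lty mTheta bTheta.

Lemma QH_norm_lty w g : (QH_norm Q Theta p w g < +oo)%E <->
  (Lp_norm Theta p w < +oo)%E /\ (Lp_norm Theta p (sqrtQ_norm Q g) < +oo)%E.
Proof.
rewrite /QH_norm; split=> [h|[h1 h2]]; last exact: lte_add_pinfty.
split; apply: le_lt_trans h; first by rewrite leeDl// Lp_norm_ge0.
by rewrite leeDr// Lp_norm_ge0.
Qed.

Lemma Lp_norm_sqrtQZ D (a : R) g :
  Lp_norm D p (sqrtQ_norm Q (fun x => a *: g x)) =
  (`|a|%:E * Lp_norm D p (sqrtQ_norm Q g))%E.
Proof.
rewrite -(normr_id a) -Lp_normZ//; apply: eq_Lp_norm => x _.
by rewrite sqrtQ_normZ.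
Qed.

(** Constants belong to the space, with gradient [0], because [Theta] has
    finite measure. *)
Lemma QH_affine w g (a c : R) : a != 0 -> QH Q Theta p w g ->
  QH Q Theta p (fun x => a * (w x - c)) (fun x => a *: g x).
Proof.
move=> a0 [mw mg /QH_norm_lty[Nw Ng] [phi [phiP phi_cvg]]].
have fin f h : measurable_fun (Theta : set (Leb R n)) f ->
    (Lp_norm Theta p f < +oo)%E -> (Lp_norm Theta p (sqrtQ_norm Q h) < +oo)%E ->
    (QH_norm Q Theta p (fun x => (a * (f x - c))%R) (fun x => a *: h x) < +oo)%E.
  move=> mf Nf Nh; apply/QH_norm_lty; split.
    by rewrite Lp_normZ// lte_mul_pinfty// Lp_norm_sub_fin.
  by rewrite Lp_norm_sqrtQZ lte_mul_pinfty.
split.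
- apply: measurable_funM; first exact: measurable_cst.
  by apply: measurable_funB; last exact: measurable_cst.
- move=> i; apply: (eq_measurable_fun (fun x : Leb R n => a * g x 0 i)).
    by move=> x _; rewrite mxE.
  by apply: measurable_funM; [exact: measurable_cst|exact: mg].
- exact: fin.
- exists (fun j x => a * (phi j x - c)); split=> [j|].
    have [lphi /QH_norm_lty[N1 N2]] := phiP j.
    split; first exact: lip_loc_affine.
    by rewrite gradient_affine//; apply: fin => //; exact: lip_loc_measurable.
  rewrite (_ : (fun _ => _) = (fun j => `|a|%:E *
      QH_norm Q Theta p (phi j \- w)%R (gradient (phi j) \- g)%R)%E).
    by rewrite -(mule0 `|a|%:E); apply: cvgeZl.
  apply/funext => j; rewrite gradient_affine// /QH_norm.
  rewrite muleDr//; last first.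
    by rewrite ge0_adde_def// inE Lp_norm_ge0.
  rewrite -Lp_normZ// -Lp_norm_sqrtQZ; congr (_ + _)%E.
    by apply: eq_Lp_norm => x _ /=; ring.
  apply: eq_Lp_norm => x _ /=; rewrite /sqrtQ_norm /=; congr (enorm (_ *m _)).
  by rewrite scalerBr.
Qed.

End degenerate_sobolev_theory.

(** * Cutting off locally Lipschitz functions *)

Section cutoff.
Variables (R : realType) (n : nat).
Implicit Types (x y z : 'rV[R]_n) (e : R) (f : 'rV[R]_n -> R).

(** Equal to [1] on the ball of radius [e] around [y], to [0] outside the ball
    of radius [2 * e]. *)
Definition cutoff y e x : R := Num.max 0 (Num.min 1 (2 - `|x - y| / e)).

Lemma cutoff_ge0 y e x : 0 <= cutoff y e x.
Proof. by rewrite /cutoff le_max lexx. Qed.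

Lemma cutoff_le1 y e x : cutoff y e x <= 1.
Proof. by rewrite /cutoff ge_max ler01 ge_min lexx. Qed.

Lemma cutoff1 y e x : 0 < e -> `|x - y| <= e -> cutoff y e x = 1.
Proof.
move=> e0 xy; have : `|x - y| / e <= 1 by rewrite ler_pdivrMr// mul1r.
move=> ?; rewrite /cutoff min_l; last lra.
by rewrite max_r.
Qed.

Lemma cutoff0 y e x : 0 < e -> 2 * e <= `|x - y| -> cutoff y e x = 0.
Proof.
move=> e0 xy; have : 2 <= `|x - y| / e by rewrite ler_pdivlMr.
move=> ?; rewrite /cutoff min_r; last lra.
by rewrite max_l//; lra.
Qed.

Lemma cutoff_lip y e x z : 0 < e ->
  `|cutoff y e x - cutoff y e z| <= e^-1 * `|x - z|.
Proof.
move=> e0.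
have d : `| `|x - y| / e - `|z - y| / e| <= e^-1 * `|x - z|.
  rewrite -mulrBl normrM mulrC ger0_norm ?invr_ge0 ?(ltW e0)//.
  rewrite ler_wpM2l ?invr_ge0 ?(ltW e0)//.
  apply: le_trans (ler_dist_dist _ _) _.
  by rewrite (_ : x - y - (z - y) = x - z)//; rewrite opprB addrA subrK.
have lip (h : R -> R) (s t : R) : (forall s t, s <= t -> 0 <= h t - h s <= t - s) ->
    `|h s - h t| <= `|s - t|.
  move=> mh; wlog st : s t / s <= t => [H|].
    by have [/H//|/ltW/H] := leP s t; rewrite (distrC (h t)) (distrC t).
  have /andP[h0 h1] := mh _ _ st.
  by rewrite distrC (distrC s) !ger0_norm// subr_ge0.
apply: le_trans (lip (fun s => Num.max 0 s) _ _ _) _ => [s t st|].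
  rewrite !maxEle; case: ifPn; case: ifPn; rewrite -?ltNge => ? ?; lra.
apply: le_trans (lip (fun s => Num.min 1 s) _ _ _) _ => [s t st|].
  rewrite !minEle; case: ifPn; case: ifPn; rewrite -?ltNge => ? ?; lra.
by rewrite (_ : _ - _ = `|z - y| / e - `|x - y| / e) 1?distrC//; ring.
Qed.

Lemma lip_loc_cutoff (U V : set 'rV[R]_n) f y e : 0 < e -> lip_loc U f ->
  ball y (3 * e) `<=` U -> lip_loc V (fun x => cutoff y e x * f x).
Proof.
move=> e0 /lip_locP lf yU; apply/lip_locP => x _.
have [xy|xy] := ltP `|x - y| (3 * e).
  have Ux : U x by apply: yU; rewrite -ball_normE /= distrC.
  have [d d0 [L L0 fL]] := lf x Ux.
  exists d => //; exists (L + (`|f x| + L * d) * e^-1).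
    by rewrite addr_ge0// mulr_ge0 ?invr_ge0 ?addr_ge0 ?mulr_ge0 ?(ltW e0) ?(ltW d0).
  move=> z1 z2 xz1 xz2.
  have fz2 : `|f z2| <= `|f x| + L * d.
    rewrite (_ : f z2 = f x + (f z2 - f x)); last by ring.
    apply: le_trans (ler_normD _ _) _; rewrite lerD2l.
    apply: le_trans (fL _ _ xz2 (ballxx _ d0)) _; rewrite ler_wpM2l//.
    by move: xz2; rewrite -ball_normE /= distrC => /ltW.
  rewrite (_ : _ - _ = cutoff y e z1 * (f z1 - f z2) +
    f z2 * (cutoff y e z1 - cutoff y e z2)); last by ring.
  apply: le_trans (ler_normD _ _) _; rewrite !normrM mulrDl lerD//.
    rewrite -[leRHS]mul1r ler_pM// ?fL//.
    by rewrite ger0_norm ?cutoff_ge0// cutoff_le1.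
  by rewrite -mulrA ler_pM// cutoff_lip.
exists e => //; exists 0 => // z1 z2 xz1 xz2; rewrite mul0r.
have far z : ball x e z -> cutoff y e z = 0.
  rewrite -ball_normE /= => xz; apply: cutoff0 => //.
  have := ler_normD (x - z) (z - y); rewrite addrA subrK => h.
  by lra.
by rewrite !far// !mul0r subrr normr0.
Qed.

End cutoff.

(** * Local oscillation of Sobolev functions *)

Lemma cvge0_near_le (R : realType) (u : nat -> \bar R) (e : R) :
  u j @[j --> \oo] --> 0%E -> 0 < e -> \forall j \near \oo, (u j <= e%:E)%E.
Proof.
move=> /fine_cvgP[ufin u0] e0.
near=> j; have uj : u j \is a fin_num by near: j.
by rewrite -(fineK uj) lee_fin; near: j; exact: cvgr_le u0 _ e0.
Unshelve. all: by end_near. Qed.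

Section local_poincare_consequences.
Variables (R : realType) (n : nat) (Omega Theta : set 'rV[R]_n).
Variables (rho : 'rV[R]_n -> 'rV[R]_n -> R) (Q : 'rV[R]_n -> 'M[R]_n).
Variables (r1 : 'rV[R]_n -> R) (p : R).
Hypotheses (ghs : geometric_homogeneous_space Omega rho)
  (QO : degenerate_matrix Q Omega) (r1_gt0 : forall x, Omega x -> 0 < r1 x)
  (oTheta : open Theta) (bTheta : bounded_set Theta)
  (ThetaOmega : Theta `<=` Omega) (p1 : 1 <= p)
  (poincare : local_poincare Q Omega rho r1 p).
Local Notation mu := (lebesgue_rV R n).

Let p0 : 0 < p := lt_le_trans ltr01 p1.

Lemma Lp_average_norm (D : set 'rV[R]_n) (f : 'rV[R]_n -> R) :
  (0 < mu D)%E -> (mu D < +oo)%E ->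
  Lp_average D p f = (((fine (mu D))^-1 `^ p^-1)%:E * Lp_norm D p f)%E.
Proof.
move=> D0 Doo; have m0 : 0 < fine (mu D) by rewrite fine_gt0// D0 Doo.
rewrite Lp_norm_integral// -poweR_EFin -poweRM ?lee_fin ?invr_ge0 ?(ltW m0)//.
by apply: integral_ge0 => x _; rewrite lee_fin powR_ge0.
Qed.

Lemma qball_center y (r : R) : Omega y -> 0 < r -> qball Omega rho y r y.
Proof.
move=> Oy r0; split => //; have [k _ H] := ghs_quasimetric ghs.
by have [_ [_ ->]] := H y y y Oy Oy Oy.
Qed.

Lemma exists_qball_subset y (U : set 'rV[R]_n) : open U -> Omega y -> U y ->
  exists2 d : R, 0 < d & qball Omega rho y d `<=` U.
Proof.
move=> oU Oy Uy; have /nbhs_ballP[e /= e0 eU] := open_nbhs_nbhs (conj oU Uy).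
have [d d0 dy] := ghs_ball_small ghs Oy e0; exists d => // x /dy[_ xy].
apply: eU; apply/(ball_rV _ _ e0) => i; apply: le_lt_trans xy.
by have := normr_le_enorm (y - x) i; rewrite !mxE.
Qed.

(** Since the hypothesis only speaks of functions that are Lipschitz near every
    point of [Omega], the function is first cut off outside a neighbourhood of
    the balls that occur in the inequality. *)
Lemma local_poincare_lip y : Theta y -> exists (B : set 'rV[R]_n) (K : R),
  [/\ open B, B y, B `<=` Theta, 0 < K &
    forall phi, lip_loc Theta phi -> exists c,
      (Lp_norm B p (fun x => (phi x - c)%R) <=
        K%:E * Lp_norm Theta p (sqrtQ_norm Q (gradient phi)))%E].
Proof.
move=> Ty; have Oy := ThetaOmega Ty.
have [C [b [C0 b1 poin]]] := poincare.
have b0 : 0 < b := lt_le_trans ltr01 b1.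
have /nbhs_ballP[e3 /= e30 e3T] := open_nbhs_nbhs (conj oTheta Ty).
pose e := e3 / 3; have e0 : 0 < e by rewrite divr_gt0.
have eT : ball y (3 * e) `<=` Theta.
  by rewrite (_ : 3 * e = e3)// /e mulrCA divff ?mulr1.
have [d d0 dy] := exists_qball_subset (ball_open y e) Oy (ballxx _ e0).
(* The larger ball, of radius [s = b * r], lies in the zone where the cutoff
   is [1]. *)
pose s := Num.min d (r1 y) / 2; pose r := s / b.
have s0 : 0 < s by rewrite divr_gt0// lt_min d0 r1_gt0.
have r0 : 0 < r by rewrite divr_gt0.
have brs : b * r = s by rewrite /r mulrCA divff ?mulr1// gt_eqF.
have sd : s < Num.min d (r1 y).
  by rewrite /s ltr_pdivrMr// ltr_pMr ?ltr1n// lt_min d0 r1_gt0.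
have sr1 : s < r1 y by apply: lt_le_trans sd _; rewrite ge_min lexx orbT.
have {}sd : s < d by apply: lt_le_trans sd _; rewrite ge_min lexx.
have rs : r <= s by rewrite /r ler_pdivrMr// ler_peMr// ltW.
pose B := qball Omega rho y r; pose B' := qball Omega rho y s.
have BB' : B `<=` B' by move=> x [Ox xr]; split => //; exact: lt_le_trans xr rs.
have B'e : B' `<=` ball y e.
  by move=> x [Ox xs]; apply: dy; split => //; exact: lt_trans xs sd.
have eTheta : ball y e `<=` Theta.
  by apply: subset_trans eT; apply: le_ball; rewrite ler_peMl ?ltW// ltr1n.
have oB : open B by exact: ghs_ball_open.
have oB' : open B' by exact: ghs_ball_open.
have By : B y by exact: qball_center.
have B'y : B' y by exact: BB'.
have BT : B `<=` Theta by apply: subset_trans BB' _; exact: subset_trans B'e eTheta.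
have B'T : B' `<=` Theta by exact: subset_trans B'e eTheta.
have mBgt0 : (0 < mu B)%E by apply: lebesgue_rV_open_gt0 => //; exists y.
have mB'gt0 : (0 < mu B')%E by apply: lebesgue_rV_open_gt0 => //; exists y.
have mlty D : open D -> D `<=` Theta -> (mu D < +oo)%E.
  move=> oD DT; apply: lebesgue_rV_bounded_lty; first exact: open_measurable_Leb.
  have [M [Mreal HM]] := bTheta.
  by exists M; split=> // N MN x /DT; exact: HM.
pose a := (fine (mu B))^-1 `^ p^-1; pose a' := (fine (mu B'))^-1 `^ p^-1.
have a0 : 0 < a.
  by rewrite powR_gt0// invr_gt0 fine_gt0// mBgt0 mlty.
have a'0 : 0 < a'.
  by rewrite powR_gt0// invr_gt0 fine_gt0// mB'gt0 mlty.
exists B, (a^-1 * (C * r * a')); split => //.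
  apply: mulr_gt0; first by rewrite invr_gt0.
  by apply: mulr_gt0 => //; exact: mulr_gt0.
move=> phi lphi.
pose f x := cutoff y e x * phi x.
have fphi x : ball y e x -> f x = phi x.
  rewrite -ball_normE /= distrC => /ltW xy.
  by rewrite /f cutoff1// mul1r.
have lf : lip_loc Omega f by exact: lip_loc_cutoff lphi eT.
have gf x : B' x -> sqrtQ_norm Q (gradient f) x = sqrtQ_norm Q (gradient phi) x.
  move=> B'x; rewrite /sqrtQ_norm (@gradient_near _ _ f phi)//.
  apply: filterS fphi _; apply: open_nbhs_nbhs; split; first exact: ball_open.
  exact: B'e.
have br : b * r < r1 y by rewrite brs.
have := poin y r Oy r0 br f lf.
rewrite /= brs -/B -/B' !Lp_average_norm ?mlty//.
rewrite (@eq_Lp_norm _ _ B' _ _ (sqrtQ_norm Q (gradient phi)))//.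
rewrite (@eq_Lp_norm _ _ B _ _ (fun x => phi x - mean B f)%R); last first.
  by move=> x /BB'/B'e/fphi ->.
rewrite -/a -/a' => H; exists (mean B f).
rewrite EFinM -muleA lee_pdivlMl// (le_trans H)// [in leRHS]EFinM -muleA.
apply: lee_wpmul2l; first by rewrite lee_fin mulr_ge0 ?(ltW C0) ?(ltW r0).
apply: lee_wpmul2l; first by rewrite lee_fin ltW.
exact: le_Lp_norm.
Qed.

(** Elements of the Sobolev space are limits of locally Lipschitz functions; the
    constant [c] is the mean of one that is close to [w], and depends on [e]. *)
Lemma local_poincare_QH y : Theta y -> exists (B : set 'rV[R]_n) (K : R),
  [/\ open B, B y, B `<=` Theta, 0 < K &
    forall w g (e : R), QH Q Theta p w g -> 0 < e -> exists c,
      (Lp_norm B p (fun x => (w x - c)%R) <=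
        K%:E * Lp_norm Theta p (sqrtQ_norm Q g) + e%:E)%E].
Proof.
move=> Ty; have [B [K [oB By BT K0 poin]]] := local_poincare_lip Ty.
exists B, K; split => // w g e [mw mg _ [phi [phiP phi_cvg]]] e0.
pose d := e / (1 + K); have K1 : 0 < 1 + K by rewrite addr_gt0.
have d0 : 0 < d by rewrite divr_gt0.
have mB := open_measurable_Leb oB.
have mT := open_measurable_Leb oTheta.
have [j phid] : exists j,
    (QH_norm Q Theta p (phi j \- w)%R (gradient (phi j) \- g)%R <= d%:E)%E.
  by have [N _ /(_ N (leqnn N)) /=] := cvge0_near_le phi_cvg d0; exists N.
have [lphi _] := phiP j; have [c Hc] := poin _ lphi; exists c.
have mphi := lip_loc_measurable oTheta lphi.
have [d1 d2] : (Lp_norm Theta p (phi j \- w)%R <= d%:E)%E /\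
    (Lp_norm Theta p (sqrtQ_norm Q (gradient (phi j) \- g)%R) <= d%:E)%E.
  split; apply: le_trans phid.
    by rewrite leeDl// Lp_norm_ge0.
  by rewrite leeDr// Lp_norm_ge0.
have mQg : measurable_fun (Theta : set (Leb R n)) (sqrtQ_norm Q g).
  exact: (measurable_sqrtQ_norm QO (ghs_open ghs)).
have Hg : (Lp_norm Theta p (sqrtQ_norm Q (gradient (phi j))) <=
    Lp_norm Theta p (sqrtQ_norm Q g) + d%:E)%E.
  apply: le_trans (_ : _ <= Lp_norm Theta p (fun x =>
    (sqrtQ_norm Q g x + sqrtQ_norm Q (gradient (phi j) \- g)%R x)%R))%E _.
    apply: le_Lp_norm => // x _; rewrite ger0_norm ?sqrtQ_norm_ge0//.
    rewrite ger0_norm ?addr_ge0 ?sqrtQ_norm_ge0//.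
    apply: le_trans (sqrtQ_normD _ _ _ _).
    by rewrite /sqrtQ_norm /= addrC subrK.
  by apply: le_trans (Lp_normD _ p1 mT mQg) _; rewrite leeD2l.
have -> : (fun x => w x - c) = (fun x => (phi j x - c) + - (phi j \- w) x).
  by apply/funext => x /=; ring.
have mphic : measurable_fun (B : set (Leb R n)) (fun x => phi j x - c).
  apply: measurable_funB; last exact: measurable_cst.
  exact: measurable_funS mphi.
apply: le_trans (Lp_normD _ p1 mB mphic) _.
rewrite Lp_normN//.
have -> : e%:E = (K%:E * d%:E + d%:E)%E.
  by rewrite -EFinM -EFinD /d; congr EFin; field; rewrite gt_eqF.
rewrite addeA -ge0_muleDr ?Lp_norm_ge0 ?lee_fin ?(ltW d0)//.
apply: leeD; first by apply: le_trans Hc _; rewrite lee_pmul2l.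
by apply: le_trans d1; exact: le_Lp_norm.
Qed.

End local_poincare_consequences.

(** * From compactness to the Poincare inequality *)

Section Lp_norm_zero.
Variables (R : realType) (n : nat).
Local Notation mu := (lebesgue_rV R n).
Implicit Types (D : set 'rV[R]_n) (p : R) (f : 'rV[R]_n -> R).

Lemma Lp_norm_eq0_ae D p f : 0 < p -> measurable (D : set (Leb R n)) ->
  measurable_fun (D : set (Leb R n)) f -> Lp_norm D p f = 0%E ->
  {ae mu, forall x, D x -> f x = 0}.
Proof.
move=> p0 mD mf; rewrite Lp_normE => /Lnorm_eq0_eq0 H.
apply: negligibleS (H _ _) => [x /= /not_implyP[Dx fx] fx0||].
- apply: fx; have := fx0 I; rewrite /= patchT ?inE// => -[].
  exact.
- exact/measurable_EFinP/(measurable_restrictT _ mD).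
- by rewrite lte_fin.
Qed.

Lemma ae_Lp_norm_eq0 D p f : 0 < p -> measurable (D : set (Leb R n)) ->
  measurable_fun (D : set (Leb R n)) f ->
  {ae mu, forall x, D x -> f x = 0} -> Lp_norm D p f = 0%E.
Proof.
move=> p0 mD mf f0; rewrite Lp_norm_integral//.
have mfp : measurable_fun (D : set (Leb R n)) (fun x => (`|f x| `^ p)%:E).
  exact/measurable_EFinP/measurable_abs_powR.
rewrite (ae_eq_integral (cst 0%E) _ mD mfp)//; last first.
  apply: negligibleS f0 => x /= nf fx; apply: nf => Dx.
  by rewrite fx// normr0 powR0// gt_eqF.
by rewrite integral0 poweR0r// invr_neq0// gt_eqF.
Qed.

(** If constants approximate a function arbitrarily well in the norm, then its
    mean does too, and the function is equal to its mean. *)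
Lemma Lp_approx_cst_ae D p f : 1 <= p -> measurable (D : set (Leb R n)) ->
  (0 < mu D)%E -> (mu D < +oo)%E ->
  measurable_fun (D : set (Leb R n)) f -> (Lp_norm D p f < +oo)%E ->
  (forall e : R, 0 < e -> exists c,
    (Lp_norm D p (fun x => (f x - c)%R) <= e%:E)%E) ->
  {ae mu, forall x, D x -> f x = mean D f}.
Proof.
move=> p1 mD D0 Doo mf Nf approx; have p0 : 0 < p := lt_le_trans ltr01 p1.
have [K K0 HK] := Lp_norm_sub_mean p1 mD D0 Doo.
suff N0 : Lp_norm D p (fun x => f x - mean D f) = 0%E.
  have mfm : measurable_fun (D : set (Leb R n)) (fun x => f x - mean D f).
    by apply: measurable_funB => //; exact: measurable_cst.
  apply: negligibleS (Lp_norm_eq0_ae p0 mD mfm N0) => x /= nf fm.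
  by apply: nf => Dx; apply/eqP; rewrite -subr_eq0 fm.
apply/eqP; rewrite eq_le Lp_norm_ge0 andbT; apply/lee_addgt0Pr => e e0.
have [c Hc] := approx (e / K) (divr_gt0 e0 K0).
rewrite add0e; apply: le_trans (HK f c mf Nf) _.
apply: (@le_trans _ _ (K%:E * (e / K)%:E)%E).
  by apply: lee_wpmul2l => //; rewrite lee_fin ltW.
by rewrite -EFinM lee_fin mulrCA divff ?mulr1// gt_eqF.
Qed.

End Lp_norm_zero.

Section poincare_of_compact_projection.
Variables (R : realType) (n : nat) (Omega Theta : set 'rV[R]_n).
Variables (rho : 'rV[R]_n -> 'rV[R]_n -> R) (Q : 'rV[R]_n -> 'M[R]_n).
Variables (r1 : 'rV[R]_n -> R) (p q : R).
Hypotheses (ghs : geometric_homogeneous_space Omega rho)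
  (QO : degenerate_matrix Q Omega) (r1_gt0 : forall x, Omega x -> 0 < r1 x)
  (oTheta : open Theta) (cTheta : connected Theta) (Theta0 : Theta !=set0)
  (bTheta : bounded_set Theta)
  (ThetaOmega : Theta `<=` Omega) (p1 : 1 <= p) (pq : p <= q)
  (poincare : local_poincare Q Omega rho r1 p)
  (cpp : compact_projection Q Theta p q).
Local Notation mu := (lebesgue_rV R n).

Let p0 : 0 < p := lt_le_trans ltr01 p1.
Let q1 : 1 <= q := le_trans p1 pq.
Let q0 : 0 < q := lt_le_trans p0 pq.
Let mTheta : measurable (Theta : set (Leb R n)) := open_measurable_Leb oTheta.
Let Theta_lty : (mu Theta < +oo)%E := lebesgue_rV_bounded_lty mTheta bTheta.
Let Theta_gt0 : (0 < mu Theta)%E := lebesgue_rV_open_gt0 oTheta Theta0.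

(** The degenerate gradient does not determine the function, but it controls its
    distance to constants near each point; this distance vanishes in the limit,
    and the connectedness of [Theta] glues the local constants. *)
Lemma limit_vanishing_gradient_cst (v : 'rV[R]_n -> R) :
  measurable_fun (Theta : set (Leb R n)) v -> (Lp_norm Theta p v < +oo)%E ->
  (forall e : R, 0 < e -> exists w g, [/\ QH Q Theta p w g,
    (Lp_norm Theta p (sqrtQ_norm Q g) <= e%:E)%E &
    (Lp_norm Theta p (w \- v)%R <= e%:E)%E]) ->
  exists c, {ae mu, forall x, Theta x -> v x = c}.
Proof.
move=> mv Nv lim; apply: connected_locally_ae_cst => // y Ty.
have [B [K [oB By BT K0 locP]]] :=
  local_poincare_QH ghs QO r1_gt0 oTheta bTheta ThetaOmega p1 poincare Ty.
exists B, (mean B v); split => //.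
have mB := open_measurable_Leb oB.
have B0 : (0 < mu B)%E by apply: lebesgue_rV_open_gt0 => //; exists y.
have Boo : (mu B < +oo)%E.
  by apply: le_lt_trans Theta_lty; apply: le_measure; rewrite ?inE.
have mvB : measurable_fun (B : set (Leb R n)) v by exact: measurable_funS mv.
apply: (Lp_approx_cst_ae p1) => //.
  by apply: le_lt_trans Nv; exact: le_Lp_norm.
move=> e e0; pose d := e / (K + 2); have K2 : 0 < K + 2 by rewrite addr_gt0.
have d0 : 0 < d by rewrite divr_gt0.
have [w [g [wg Ng Nw]]] := lim d d0.
have [c Hc] := locP w g d wg d0; exists c.
have mw : measurable_fun (Theta : set (Leb R n)) w by case: wg.
have mwc : measurable_fun (B : set (Leb R n)) (fun x => w x - c).
  apply: measurable_funB; last exact: measurable_cst.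
  exact: measurable_funS mw.
rewrite (_ : (fun x => v x - c) = (fun x => (w x - c) + - (w \- v) x)); last first.
  by apply/funext => x /=; ring.
apply: le_trans (Lp_normD _ p1 mB mwc) _; rewrite Lp_normN//.
have -> : e%:E = (K%:E * d%:E + d%:E + d%:E)%E.
  by rewrite -EFinM -!EFinD /d; congr EFin; field; rewrite gt_eqF.
apply: leeD; last by apply: le_trans Nw; exact: le_Lp_norm.
apply: le_trans Hc _; rewrite leeD2r//.
by apply: lee_wpmul2l => //; rewrite lee_fin ltW.
Qed.

(** Otherwise some [W k] have a deviation from their mean more than [k.+1]
    times as large as their gradient.  Dividing by the deviation gives a bounded
    sequence [u k] with gradients tending to [0]; by compactness a subsequence
    converges, to a constant [c].  But [u k] is a normalized deviation from a
    mean, and so stays away from all constants. *)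
Lemma poincare_exponent_q : exists2 C : R, 0 < C & forall w g,
  QH Q Theta p w g ->
  (Lp_norm Theta q (fun x => (w x - mean Theta w)%R) <=
    C%:E * Lp_norm Theta p (sqrtQ_norm Q g))%E.
Proof.
apply: contrapT => noC.
have seqP k : exists wg : ('rV[R]_n -> R) * ('rV[R]_n -> 'rV[R]_n),
    QH Q Theta p wg.1 wg.2 /\
    (k.+1%:R%:E * Lp_norm Theta p (sqrtQ_norm Q wg.2) <
     Lp_norm Theta q (fun x => (wg.1 x - mean Theta wg.1)%R))%E.
  apply: contrapT => nwg; apply: noC; exists k.+1%:R => // w g wg.
  by rewrite leNgt; apply/negP => H; apply: nwg; exists (w, g).
have {noC}[WG WGP] := choice seqP.
pose W k := (WG k).1; pose G k := (WG k).2.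
have WGQ k : QH Q Theta p (W k) (G k) := (WGP k).1.
have mW k : measurable_fun (Theta : set (Leb R n)) (W k) by case: (WGQ k).
have NW k : (Lp_norm Theta q (W k) < +oo)%E by have [] := cpp.1 _ _ (WGQ k).
pose m k := mean Theta (W k).
pose N k := fine (Lp_norm Theta q (fun x => (W k x - m k)%R)).
have NE k : Lp_norm Theta q (fun x => (W k x - m k)%R) = (N k)%:E.
  by rewrite fineK// ge0_fin_numE ?Lp_norm_ge0// Lp_norm_sub_fin.
have HN k : (k.+1%:R%:E * Lp_norm Theta p (sqrtQ_norm Q (G k)) < (N k)%:E)%E.
  by rewrite -NE; exact: (WGP k).2.
have N0 k : 0 < N k.
  rewrite -lte_fin; apply: le_lt_trans (HN k).
  by rewrite mule_ge0 ?lee_fin ?Lp_norm_ge0.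
pose u k x := (N k)^-1 * (W k x - m k).
pose h k x := (N k)^-1 *: G k x.
have uhQ k : QH Q Theta p (u k) (h k).
  by apply: QH_affine => //; rewrite invr_eq0 gt_eqF.
have mfu k : measurable_fun (Theta : set (Leb R n)) (u k) by case: (uhQ k).
have Nu k : Lp_norm Theta q (u k) = 1%E.
  rewrite (@Lp_normZ _ _ _ _ _ (fun x => W k x - m k))//.
  rewrite NE ger0_norm ?invr_ge0 ?(ltW (N0 k))// -EFinM.
  by rewrite mulVf// gt_eqF.
have Nh k : (Lp_norm Theta p (sqrtQ_norm Q (h k)) <= (k.+1%:R^-1)%:E)%E.
  have -> : Lp_norm Theta p (sqrtQ_norm Q (h k)) =
      (`|(N k)^-1|%:E * Lp_norm Theta p (sqrtQ_norm Q (G k)))%E.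
    exact: Lp_norm_sqrtQZ.
  rewrite ger0_norm ?invr_ge0 ?(ltW (N0 k))//.
  rewrite lee_pdivrMl// -EFinM mulrC EFinM -lee_pdivrMl//.
  by rewrite invrK ltW.
pose M := 1 + fine (mu Theta).
have M0 : 0 < M by rewrite ltr_wpDr// fine_ge0.
have le_pq f : measurable_fun (Theta : set (Leb R n)) f ->
    (Lp_norm Theta p f <= M%:E * Lp_norm Theta q f)%E.
  by move=> mf; exact: Lp_norm_inclusion.
have bounded k : (QH_norm Q Theta p (u k) (h k) <= (M + 1)%:E)%E.
  rewrite EFinD; apply: leeD; first by rewrite -[M%:E]mule1 -(Nu k) le_pq.
  apply: le_trans (Nh k) _; rewrite lee_fin invf_le1// ler1n//.
have [s [s_incr [v [mv Nv] u_cvg]]] := cpp.2 u h (M + 1) uhQ bounded.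
have s_ge k : (k <= s k)%N.
  by elim: k => // k IHk; apply: leq_ltn_trans IHk _; exact: s_incr.
have close (e : R) : 0 < e -> exists k, (k.+1%:R^-1 <= e)%R /\
    (Lp_norm Theta q (u k \- v)%R <= e%:E)%E.
  move=> e0.
  have [k0 _ Hk0] := cvge0_near_le u_cvg e0.
  have [k1 _ Hk1] := near_infty_natSinv_lt (PosNum e0).
  exists (s (maxn k0 k1)); split; last by apply: Hk0; rewrite /= leq_maxl.
  apply: ltW; apply: Hk1; rewrite /=; apply: leq_trans (s_ge _).
  exact: leq_maxr.
have muv k : measurable_fun (Theta : set (Leb R n)) (u k \- v).
  by apply: measurable_funB.
have [c vc] : exists c, {ae mu, forall x, Theta x -> v x = c}.
  apply: limit_vanishing_gradient_cst => //.
    by apply: le_lt_trans (le_pq _ mv) _; rewrite lte_mul_pinfty// lee_fin ltW.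
  move=> e e0.
  (* Closeness is known for the exponent [q]; the exponent [p] costs a factor
     [M]. *)
  pose d := Num.min e (e / M).
  have d0 : 0 < d by rewrite lt_min e0 divr_gt0.
  have [k [kd kv]] := close d d0.
  exists (u k), (h k); split => //.
    by apply: le_trans (Nh k) _; rewrite lee_fin (le_trans kd)// ge_min lexx.
  apply: le_trans (le_pq _ (muv k)) _.
  rewrite -lee_pdivlMl// (le_trans kv)// -EFinM lee_fin mulrC.
  by rewrite ge_min lexx orbT.
have [A A0 HA] := Lp_norm_sub_mean q1 mTheta Theta_gt0 Theta_lty.
have A2 : 0 < (2 * A)^-1 by rewrite invr_gt0 mulr_gt0.
have [k [_ kv]] := close _ A2.
have mvc : measurable_fun (Theta : set (Leb R n)) (fun x => v x - c).
  by apply: measurable_funB => //; exact: measurable_cst.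
have vc0 : Lp_norm Theta q (fun x => v x - c) = 0%E.
  apply: ae_Lp_norm_eq0 => //; apply: negligibleS vc => x /= nv vxc.
  by apply: nv => /vxc ->; rewrite subrr.
have uc : (Lp_norm Theta q (fun x => (u k x - c)%R) <= ((2 * A)^-1)%:E)%E.
  rewrite (_ : (fun x => u k x - c) = (fun x => (u k \- v) x + (v x - c))); last first.
    by apply/funext => x /=; ring.
  by apply: le_trans (Lp_normD _ q1 mTheta (muv k)) _; rewrite vc0 adde0.
(* In terms of [W k] the constant [c] becomes [m k + N k * c]. *)
have := HA (W k) (m k + N k * c) (mW k) (NW k).
rewrite -/(m k) NE (_ : (fun x => _) = (fun x => N k * (u k x - c))); last first.
  by apply/funext => x; rewrite /u; field; rewrite gt_eqF.
rewrite Lp_normZ// (ger0_norm (ltW (N0 k))) => H.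
have : ((N k)%:E <= A%:E * ((N k)%:E * ((2 * A)^-1)%:E))%E.
  apply: le_trans H _; apply: lee_wpmul2l; first by rewrite lee_fin ltW.
  by apply: lee_wpmul2l => //; rewrite lee_fin ltW.
rewrite -!EFinM lee_fin (_ : A * _ = N k / 2); last by field; rewrite gt_eqF.
by have := N0 k; lra.
Qed.

End poincare_of_compact_projection.

Theorem theorem5p1 (R : realType) (n : nat) (n_gt0 : (0 < n)%N)
    (Omega : set 'rV[R]_n) (rho : 'rV[R]_n -> 'rV[R]_n -> R)
    (Q : 'rV[R]_n -> 'M[R]_n) (r1 : 'rV[R]_n -> R)
    (Theta : set 'rV[R]_n) (p q : R) :
  geometric_homogeneous_space Omega rho ->
  degenerate_matrix Q Omega ->
  {within Omega, continuous r1} ->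
  (forall x, Omega x -> 0 < r1 x) ->
  open Theta -> connected Theta -> Theta !=set0 -> bounded_set Theta ->
  closure Theta `<=` Omega ->
  1 <= p -> p <= q ->
  local_poincare Q Omega rho r1 p ->
  compact_projection Q Theta p q ->
  exists2 C5 : R, 0 < C5 &
    forall (r : R) (w : 'rV[R]_n -> R) (g : 'rV[R]_n -> 'rV[R]_n),
      1 <= r -> r <= q -> QH Q Theta p w g ->
      (Lp_norm Theta r (fun x => w x - mean Theta w)%R <=
       C5%:E * Lp_norm Theta p (sqrtQ_norm Q g))%E.
Proof.
move=> ghs QO _ r1_gt0 oT cT T0 bT ClT p1 pq poincare cpp.
have TO : Theta `<=` Omega by apply: subset_trans ClT; exact: subset_closure.
have mT := open_measurable_Leb oT.
have Too := lebesgue_rV_bounded_lty mT bT.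
have [C C0 HC] :=
  poincare_exponent_q ghs QO r1_gt0 oT cT T0 bT TO p1 pq poincare cpp.
pose M := 1 + fine (lebesgue_rV R n Theta).
have M0 : 0 < M by rewrite ltr_wpDr// fine_ge0.
exists (M * C); first exact: mulr_gt0.
move=> r w g r_ge1 rq wg.
have mw : measurable_fun (Theta : set (Leb R n)) (fun x => w x - mean Theta w).
  by apply: measurable_funB; [case: wg|exact: measurable_cst].
apply: le_trans (Lp_norm_inclusion r_ge1 rq mT Too mw) _.
by rewrite EFinM -muleA; apply: lee_wpmul2l; [rewrite lee_fin ltW|exact: HC].
Qed.
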